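(* Let $\Bbbk$ be a field. For any integer $r \geq 1$ there is a connected cograph $G$ with $\operatorname{reg}(S/J_G)=r$. If $r$ is even, then there is such a graph with $\frac{3}{2}r+1$ vertices. If $r$ is odd, then there is such a graph with $\frac{3}{2}(r+3)$ vertices.
   Context: All graphs are finite, simple and undirected, with nonempty vertex set. A cograph (complement reducible graph) is a graph having no induced subgraph that is a path on $4$ vertices. For a graph $G$ with vertex set $[n]=\{1,\dots,n\}$ and edge set $E$, let $S=\Bbbk[x_1,\dots,x_n,y_1,\dots,y_n]$ be the standard graded polynomial ring over the field $\Bbbk$; the binomial edge ideal of $G$ is $J_G=\langle x_iy_j-y_ix_j : \{i,j\}\in E\rangle\subseteq S$. The graded Betti numbers are $\beta_{i,j}(S/J_G)=\dim_\Bbbk \operatorname{Tor}_i^S(S/J_G,\Bbbk)_j$, and the Castelnuovo--Mumford regularity is $\operatorname{reg}(S/J_G)=\max\{j-i : \beta_{i,j}(S/J_G)\neq 0\}$. *)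

(* Defs.v *)
From HB Require Import structures.
From mathcomp Require Import all_boot all_order all_algebra.
From mathcomp Require Import mpoly.
From Stdlib Require Import ClassicalEpsilon.

Set Implicit Arguments.
Unset Strict Implicit.
Unset Printing Implicit Defensive.

Import GRing.Theory.
Local Open Scope ring_scope.

Record sgraph (n : nat) := SGraph {
  edge :> rel 'I_n;
  edge_sym : ssrbool.symmetric edge;
  edge_irr : ssrbool.irreflexive edge }.

Definition connected_graph n (G : sgraph n) : Prop :=
  (0 < n)%N /\ forall u v : 'I_n, connect G u v.

Definition P4 : rel 'I_4 := fun a b => (a.+1 == b :> nat) || (b.+1 == a :> nat).

Definition cograph n (G : sgraph n) : Prop :=
  ~ exists f : 'I_4 -> 'I_n, injective f /\ forall a b, G (f a) (f b) = P4 a b.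

Section GradedBetti.
Variables (K : fieldType) (N : nat).
Local Notation S := {mpoly K[N]}.

(* A sequence ... -> F_2 -> F_1 -> F_0 of finitely generated graded free
   S-modules together with an augmentation F_0 -> S.  F_i is the module of row
   vectors of length [rk i], its p-th basis vector having degree [sh p], and
   matrices act on the right: v |-> v *m diff i maps F_(i+1) to F_i. *)
Record graded_free_seq := GradedFreeSeq {
  rk : nat -> nat;
  sh : forall i, 'I_(rk i) -> int;
  diff : forall i, 'M[S]_(rk i.+1, rk i);
  aug : 'cV[S]_(rk 0) }.

(* F is a graded free resolution of S/J.  As F_0 is free, F_0 -> S/J is given
   by a lift [aug F] to S; it is read modulo J.  The first two clauses say that
   all maps are homogeneous of degree 0, the last three that
   ... -> F_1 -> F_0 -> S/J -> 0 is exact. *)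
Definition is_resolution (J : S -> Prop) (F : graded_free_seq) : Prop :=
  [/\ forall i (p : 'I_(rk F i.+1)) (q : 'I_(rk F i)) m,
        m \in msupp (diff F i p q) -> (mdeg m)%:Z + sh q = sh p,
      forall (p : 'I_(rk F 0)) m,
        m \in msupp (aug F p 0) -> (mdeg m)%:Z = sh p,
      forall f : S, exists v : 'rV_(rk F 0), J (f - (v *m aug F) 0 0),
      forall v : 'rV_(rk F 0),
        J ((v *m aug F) 0 0) <-> exists w, v = w *m diff F 0
    & forall i (v : 'rV_(rk F i.+1)),
        v *m diff F i = 0 <-> exists w, v = w *m diff F i.+1].

Variable F : graded_free_seq.

(* The differential of the complex F (x)_S K of K-vector spaces: S acts on
   K = S/(variables) through the constant coefficient. *)
Definition tdiff i : 'M[K]_(rk F i.+1, rk F i) :=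
  map_mx (mcoeff 0%MM) (diff F i).

Definition tcycles i : 'M[K]_(rk F i) :=
  match i with
  | 0 => 1%:M
  | i'.+1 => kermx (tdiff i')
  end.

(* Its row space is the degree j part of F_i (x) K. *)
Definition tdeg i (j : int) : 'M[K]_(rk F i) :=
  diag_mx (\row_p (sh p == j)%:R).

(* The K-dimension of H_i(F (x)_S K)_j. *)
Definition homology_dim i (j : int) : nat :=
  (\rank (tcycles i :&: tdeg i j)%MS - \rank (tdiff i :&: tdeg i j)%MS)%N.

End GradedBetti.

Definition zero_seq (K : fieldType) (N : nat) : graded_free_seq K N :=
  @GradedFreeSeq K N (fun=> 0%N) (fun _ _ => 0) (fun=> 0) 0.

(* A chosen graded free resolution of S/J.  One exists for every homogeneous
   ideal J, by Hilbert's basis theorem; the default value is irrelevant. *)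
Definition resolution (K : fieldType) (N : nat) (J : {mpoly K[N]} -> Prop) :
    graded_free_seq K N :=
  epsilon (inhabits (zero_seq K N)) (is_resolution J).

(* dim_K Tor_i^S(S/J, K)_j *)
Definition betti (K : fieldType) (N : nat) (J : {mpoly K[N]} -> Prop)
    (i : nat) (j : int) : nat :=
  homology_dim (resolution J) i j.

(* r = max {j - i : beta_{i,j}(S/J) <> 0} *)
Definition is_regularity (K : fieldType) (N : nat) (J : {mpoly K[N]} -> Prop)
    (r : int) : Prop :=
  (exists i j, betti J i j <> 0%N /\ j - i%:Z = r) /\
  (forall i j, betti J i j <> 0%N -> j - i%:Z <= r).

(* x_i is the variable of index i and y_i the one of index n + i. *)
Definition edge_binomial (K : fieldType) n (i j : 'I_n) : {mpoly K[n + n]} :=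
  'X_(lshift n i) * 'X_(rshift n j) - 'X_(rshift n i) * 'X_(lshift n j).

Definition binomial_edge_ideal (K : fieldType) n (G : sgraph n)
    (f : {mpoly K[n + n]}) : Prop :=
  exists c : 'I_n -> 'I_n -> {mpoly K[n + n]},
    f = \sum_(i < n) \sum_(j < n | G i j) c i j * edge_binomial K i j.

(* Main.v *)
Require Import Defs.
From HB Require Import structures.
From mathcomp Require Import all_boot all_order all_algebra.
From mathcomp Require Import mpoly zify ring.
From Stdlib Require Import Classical ClassicalEpsilon.

(* For a cone G over H with apex v, J_G : x_v = J_{K_n}, (J_G + x_v) : y_v is
   generated by x_1, ..., x_n, and J_G + (x_v, y_v) = J_H + (x_v, y_v).  The long
   exact sequences of Tor for S/(J : f)(-deg f) -> S/J -> S/(J + f) thus compare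
   S/J_G with S/J_H, and give reg S/J_{K_n} = 1 by induction on n, since x_v is
   regular modulo the toric ideal J_{K_n}.  If H is a disjoint union of paths,
   then J_H is a complete intersection of quadrics (the leading monomials
   x_i y_(i+1) are pairwise coprime), so reg S/J_H is its number of edges.  Take
   G to be the cone over copies of the path on 3 vertices, together with one edge
   and three isolated vertices if r >= 3 is odd, and the complete graph K_6 if
   r = 1.  Tor is independent of the chosen resolution by the comparison theorem,
   and the connecting maps come from mapping cones. *)

Set Implicit Arguments.
Unset Strict Implicit.
Unset Printing Implicit Defensive.

Import Order.TTheory GRing.Theory Num.Theory.
Local Open Scope ring_scope.

(** * Homogeneous polynomials *)

Section Homogeneity.
Variables (K : fieldType) (N : nat).
Local Notation S := {mpoly K[N]}.
Implicit Types (p q f g : S) (d e : int).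

(** The Betti numbers of the statement come from an epsilon-chosen resolution, so nothing can be
    computed before graded resolutions are known to exist (Dickson's lemma and a basis theorem) and
    to give the same Tor. Only the vanishing of Betti numbers enters the regularity; hence Tor is
    handled as the existence of a homogeneous cycle that is not a boundary, and the long exact
    sequence as three disjunctions of nonvanishing statements, without dimensions. All graphs share
    one ring S: a vertex is deleted by adding its two variables to the ideal, which leaves the
    regularity unchanged. For a cone, the complete graph contributes only to j - i at most 2, so reg
    S/J_G equals reg S/J_H once the latter is at least 2; this is why r = 1 is treated by a complete
    graph. For even r, r/2 paths on 3 vertices and the apex give 3r/2 + 1 vertices. For odd r >= 3,
    (r-1)/2 such paths, an edge, three isolated vertices and the apex give 3(r-1)/2 + 6 = 3(r+3)/2;
    the isolated vertices pad the graph to the prescribed size, which is 6 for r = 1. *)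

Definition ishom e p := forall m, m \in msupp p -> (mdeg m)%:Z = e.

Lemma ishom0 e : ishom e 0.
Proof. by move=> m; rewrite msupp0. Qed.

Lemma ishomD e p q : ishom e p -> ishom e q -> ishom e (p + q).
Proof.
by move=> hp hq m /msuppD_le; rewrite mem_cat => /orP[/hp|/hq].
Qed.

Lemma ishomN e p : ishom e p -> ishom e (- p).
Proof. by move=> hp m; rewrite (perm_mem (msuppN _)) => /hp. Qed.

Lemma ishomB e p q : ishom e p -> ishom e q -> ishom e (p - q).
Proof. by move=> hp hq; apply: ishomD => //; apply: ishomN. Qed.

Lemma ishomM d e p q : ishom d p -> ishom e q -> ishom (d + e) (p * q).
Proof.
move=> hp hq m /msuppM_le /allpairsP[[m1 m2] /= [/hp <- /hq <- ->]].
by rewrite mdegD PoszD.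
Qed.

Lemma ishom_sum (I : Type) (r : seq I) (P : pred I) (F : I -> S) e :
  (forall i, P i -> ishom e (F i)) -> ishom e (\sum_(i <- r | P i) F i).
Proof.
move=> h; elim/big_rec: _ => [|i x Pi hx]; first exact: ishom0.
by apply: ishomD => //; apply: h.
Qed.

Lemma ishomX m : ishom (mdeg m)%:Z ('X_[m] : S).
Proof. by move=> k /mem_msuppXP <-. Qed.

Lemma ishom_var i : ishom 1 ('X_i : S).
Proof. by move=> m /mem_msuppXP <-; rewrite mdeg1. Qed.

Lemma ishom1 : ishom 0 (1 : S).
Proof. by move=> m; rewrite -mpolyX0 => /mem_msuppXP <-; rewrite mdeg0. Qed.

Definition hpart e p : S := \sum_(m <- msupp p | (mdeg m)%:Z == e) p@_m *: 'X_[m].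

Lemma mcoeff_hpart e p m : (hpart e p)@_m = if (mdeg m)%:Z == e then p@_m else 0.
Proof.
rewrite /hpart raddf_sum /=.
under eq_bigr do rewrite mcoeffZ mcoeffX.
case: (boolP (m \in msupp p)) => mp; last first.
  rewrite (memN_msupp_eq0 mp) if_same big_seq_cond big1 // => k /andP[kp _].
  by case: eqP => [km|_]; [rewrite -km kp in mp | rewrite mulr0].
rewrite -big_filter; case: ifP => dm; last first.
  rewrite big_seq_cond big1 // => k; rewrite mem_filter andbT => /andP[dk _].
  by case: eqP => [km|_]; [rewrite -km dk in dm | rewrite mulr0].
rewrite (bigD1_seq m) /= ?mem_filter ?dm ?filter_uniq ?msupp_uniq //.
by rewrite eqxx mulr1 big1 ?addr0 // => k /negbTE->; rewrite mulr0.
Qed.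

Lemma hpart_is_linear e : linear (hpart e).
Proof.
move=> c p q; apply/mpolyP => m.
rewrite mcoeffD mcoeffZ !mcoeff_hpart mcoeffD mcoeffZ.
by case: ifP => // _; rewrite mulr0 addr0.
Qed.

HB.instance Definition _ e :=
  GRing.isLinear.Build K S S _ (hpart e) (hpart_is_linear e).

Lemma ishom_hpart e p : ishom e (hpart e p).
Proof.
move=> m; rewrite mcoeff_msupp mcoeff_hpart.
by case: (eqVneq (mdeg m)%:Z e) => [-> //|_]; rewrite eqxx.
Qed.

Lemma hpart_ishom d e p : ishom d p -> hpart e p = if d == e then p else 0.
Proof.
move=> hp; apply/mpolyP => m; rewrite mcoeff_hpart.
case: (boolP (m \in msupp p)) => [/hp <-|mp]; first by case: ifP; rewrite ?mcoeff0.
by rewrite (fun_if (mcoeff m)) (memN_msupp_eq0 mp) mcoeff0 !if_same.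
Qed.

Lemma hpart_id e p : ishom e p -> hpart e p = p.
Proof. by move=> hp; rewrite (hpart_ishom _ hp) eqxx. Qed.

(** Valid for every integer [e]; both sides vanish when [e - d] is negative. It cuts an identity
    down to one degree, which turns arbitrary lifts into graded ones. *)
Lemma hpartM d e p q : ishom d q -> hpart e (p * q) = hpart (e - d) p * q.
Proof.
move=> hq; rewrite {1 2}[p]mpolyE mulr_suml !raddf_sum mulr_suml /=.
apply: eq_bigr => m _; rewrite -scalerAl !linearZ -scalerAl /=; congr (_ *: _).
rewrite (hpart_ishom _ (ishomM (@ishomX m) hq)) (hpart_ishom _ (@ishomX m)).
have -> : ((mdeg m)%:Z == e - d) = ((mdeg m)%:Z + d == e) by rewrite eq_sym subr_eq eq_sym.
by case: ifP; rewrite ?mul0r.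
Qed.

End Homogeneity.

(** * Graded matrices and comparison of resolutions *)

(** Chain maps and homotopies are built level by level, in types depending on the level; [P] is the
    invariant that makes the next choice possible, [R] links consecutive choices. *)
Lemma dependent_choice (T : nat -> Type) (P : forall i, T i -> Prop)
    (R : forall i, T i -> T i.+1 -> Prop) :
  (exists a, P 0%N a) ->
  (forall i a, P i a -> exists b, P i.+1 b /\ R i a b) ->
  exists u : forall i, T i, forall i, P i (u i) /\ R i (u i) (u i.+1).
Proof.
move=> /constructive_indefinite_description[a0 Pa0] step.
have next i (a : {a : T i | P i a}) :
    {b : {b : T i.+1 | P i.+1 b} | R i (sval a) (sval b)}.
  apply: constructive_indefinite_description; case: a => a Pa; have [b [Pb Rab]] := step _ _ Pa.
  by exists (exist _ b Pb).
pose u := nat_rect (fun i => {a : T i | P i a}) (exist _ a0 Pa0)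
  (fun i a => sval (next i a)).
by exists (fun i => sval (u i)) => i; split; [exact: svalP (u i) | exact: svalP (next i (u i))].
Qed.

Section GradedMatrices.
Variables (K : fieldType) (N : nat).
Local Notation S := {mpoly K[N]}.

(** Matrices act on row vectors from the right, so row [p] is the image of a basis vector of degree
    [s p], and the condition is homogeneity of degree 0. *)
Definition graded_mx a b (s : 'I_a -> int) (t : 'I_b -> int) (A : 'M[S]_(a, b)) :=
  forall p q, ishom (s p - t q) (A p q).

Lemma graded_mxM a b c (s : 'I_a -> int) (t : 'I_b -> int) (u : 'I_c -> int)
    (A : 'M[S]_(a, b)) (B : 'M[S]_(b, c)) :
  graded_mx s t A -> graded_mx t u B -> graded_mx s u (A *m B).
Proof.
move=> hA hB p q; rewrite mxE; apply: ishom_sum => k _.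
have -> : s p - u q = (s p - t k) + (t k - u q) by ring.
exact: ishomM.
Qed.

Lemma lift_mx a b c (D : 'M[S]_(b, a)) (B : 'M[S]_(c, a)) :
  (forall p, exists w, row p B = w *m D) -> exists W, B = W *m D.
Proof.
move=> /fin_all_exists[w hw]; exists (\matrix_p w p).
by apply/row_matrixP => p; rewrite row_mul rowK hw.
Qed.

(** An arbitrary lift is corrected by keeping in each entry only the part of the required degree;
    the equation survives because [D] and [B] are homogeneous. *)
Lemma lift_graded_mx a b c (s : 'I_c -> int) (t : 'I_b -> int) (u : 'I_a -> int)
    (D : 'M[S]_(b, a)) (B : 'M[S]_(c, a)) :
  graded_mx t u D -> graded_mx s u B ->
  (forall p, exists w, row p B = w *m D) ->
  exists W, graded_mx s t W /\ B = W *m D.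
Proof.
move=> hD hB /lift_mx[W BW]; exists (\matrix_(p, q) hpart (s p - t q) (W p q)); split.
  by move=> p q; rewrite mxE; apply: ishom_hpart.
apply/matrixP => p r; rewrite -[LHS](hpart_id (hB p r)) BW !mxE raddf_sum /=.
apply: eq_bigr => q _; rewrite mxE (hpartM _ _ (hD q r)); congr (hpart _ _ * _); ring.
Qed.

Definition degree_mx a (s : 'I_a -> int) (j : int) : 'M[K]_a :=
  diag_mx (\row_p (s p == j)%:R).

(** A nonzero constant term joins basis vectors of equal degree, so reduction modulo the variables
    commutes with projection to degree [j]. *)
Lemma degree_mxC a b (s : 'I_a -> int) (t : 'I_b -> int) (A : 'M[S]_(a, b)) j :
  graded_mx s t A ->
  degree_mx s j *m map_mx (mcoeff 0%MM) A = map_mx (mcoeff 0%MM) A *m degree_mx t j.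
Proof.
move=> hA; apply/matrixP => p q; rewrite mul_diag_mx mul_mx_diag !mxE.
case: (eqVneq (A p q)@_0%MM 0) => [->|nz]; first by rewrite mulr0 mul0r.
have := hA p q 0%MM; rewrite mcoeff_msupp nz mdeg0 => /(_ isT)/esym/eqP.
by rewrite subr_eq0 => /eqP->; rewrite mulrC.
Qed.

Lemma degree_mx_shift a (s : 'I_a -> int) d j :
  degree_mx (fun p => s p + d) j = degree_mx s (j - d).
Proof.
congr diag_mx; apply/rowP => p; rewrite !mxE.
by rewrite eq_sym -subr_eq eq_sym.
Qed.

Lemma degree_mx_idem a (s : 'I_a -> int) j :
  degree_mx s j *m degree_mx s j = degree_mx s j.
Proof.
rewrite mulmx_diag; congr diag_mx; apply/rowP => p.
by rewrite !mxE; case: (s p == j); rewrite ?mulr1 ?mulr0.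
Qed.

End GradedMatrices.

(** * Tor computed from one resolution, and its independence of the choice *)

Section Tor.
Variables (K : fieldType) (N : nat).
Local Notation S := {mpoly K[N]}.
Implicit Types (J : S -> Prop) (F : graded_free_seq K N).

Definition ideal J :=
  [/\ J 0, forall p q, J p -> J q -> J (p + q) & forall p q, J q -> J (p * q)].

Definition homogeneous_ideal J := ideal J /\ forall e p, J p -> J (hpart e p).

Lemma ideal_opp J p : ideal J -> J p -> J (- p).
Proof. by case=> _ _ JM Jp; rewrite -mulN1r; apply: JM. Qed.

Lemma ideal_sub J p q : ideal J -> J p -> J q -> J (p - q).
Proof. by move=> iJ Jp Jq; case: (iJ) => _ JD _; apply: JD => //; apply: ideal_opp. Qed.

Lemma ideal_mulr J p q : ideal J -> J p -> J (p * q).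
Proof. by case=> _ _ JM Jp; rewrite mulrC; apply: JM. Qed.

Lemma ideal_sum J (I : Type) (r : seq I) (P : pred I) (G : I -> S) :
  ideal J -> (forall i, P i -> J (G i)) -> J (\sum_(i <- r | P i) G i).
Proof.
by case=> J0 JD _ h; elim/big_rec: _ => // i x Pi Jx; apply: JD => //; apply: h.
Qed.

Local Notation red A := (map_mx (mcoeff 0%MM) A).

Definition tor_cycle F i : 'rV[K]_(rk F i) -> Prop :=
  match i with
  | 0 => fun=> True
  | i'.+1 => fun z => z *m tdiff F i' = 0
  end.

Definition tor_boundary F i (z : 'rV[K]_(rk F i)) := exists y, z = y *m tdiff F i.

Definition tor_nonzero F i (j : int) :=
  exists z : 'rV[K]_(rk F i),
    [/\ z *m tdeg F i j = z, tor_cycle z & ~ tor_boundary z].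

Lemma res_diff_graded J F : is_resolution J F ->
  forall i, graded_mx (@sh _ _ F i.+1) (@sh _ _ F i) (diff F i).
Proof. by case=> h _ _ _ _ i p q m /h <-; rewrite addrK. Qed.
Arguments res_diff_graded {J F}.

Lemma res_aug_graded J F : is_resolution J F -> forall p, ishom (sh p) (aug F p 0).
Proof. by case=> _ h _ _ _ p m; apply: h. Qed.
Arguments res_aug_graded {J F}.

Lemma res_diff_diff J F i : is_resolution J F -> diff F i.+1 *m diff F i = 0.
Proof.
case=> _ _ _ _ ex; apply/row_matrixP => p; rewrite row_mul row0.
by apply/ex; exists (delta_mx 0 p); rewrite rowE.
Qed.

Lemma res_diff_aug J F (w : 'rV_(rk F 1)) : is_resolution J F -> J ((w *m diff F 0 *m aug F) 0 0).
Proof. by case=> _ _ _ ex0 _; apply/ex0; exists w. Qed.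

Lemma res_exact J F i (v : 'rV_(rk F i.+1)) :
  is_resolution J F -> v *m diff F i = 0 -> exists w, v = w *m diff F i.+1.
Proof. by case=> _ _ _ _ ex /ex. Qed.

Lemma tdiff_tdiff J F i : is_resolution J F -> tdiff F i.+1 *m tdiff F i = 0.
Proof. by move=> rF; rewrite /tdiff -map_mxM (res_diff_diff _ rF) map_mx0. Qed.

Lemma tor_boundary_cycle J F i (z : 'rV[K]_(rk F i)) :
  is_resolution J F -> tor_boundary z -> tor_cycle z.
Proof.
by case: i z => // i z rF [y ->] /=; rewrite -mulmxA (tdiff_tdiff _ rF) mulmx0.
Qed.

Lemma tdeg_tdiff J F i j :
  is_resolution J F -> tdeg F i.+1 j *m tdiff F i = tdiff F i *m tdeg F i j.
Proof. by move=> rF; apply: degree_mxC; exact: res_diff_graded rF _. Qed.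

Lemma tor_cycle_deg J F i j (z : 'rV[K]_(rk F i)) :
  is_resolution J F -> tor_cycle z -> tor_cycle (z *m tdeg F i j).
Proof.
case: i z => // i z rF /= zd.
by rewrite -mulmxA (tdeg_tdiff _ _ rF) mulmxA zd mul0mx.
Qed.

Lemma tor_zero_boundary J F i j (z : 'rV[K]_(rk F i)) :
  is_resolution J F -> ~ tor_nonzero F i j -> tor_cycle z ->
  tor_boundary (z *m tdeg F i j).
Proof.
move=> rF nz zc; apply: NNPP => nb; apply: nz; exists (z *m tdeg F i j); split=> //.
  by rewrite -mulmxA degree_mx_idem.
exact: tor_cycle_deg rF zc.
Qed.

Lemma tor_boundary_deg J F i j (z : 'rV[K]_(rk F i)) :
  is_resolution J F -> tor_boundary z -> z *m tdeg F i j = z ->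
  exists2 y, y *m tdeg F i.+1 j = y & z = y *m tdiff F i.
Proof.
move=> rF [y zy] zj; exists (y *m tdeg F i.+1 j); first by rewrite -mulmxA degree_mx_idem.
by rewrite -mulmxA (tdeg_tdiff _ _ rF) mulmxA -zy.
Qed.

(** Boundaries of degree [j] lie among the cycles of degree [j], so the difference of ranks is
    nonzero exactly when the inclusion is strict; a row of the cycle space outside the boundaries is
    then a witness. *)
Lemma homology_dim_neq0 J F i j :
  is_resolution J F -> homology_dim F i j <> 0%N <-> tor_nonzero F i j.
Proof.
move=> rF; have cycE (z : 'rV_(rk F i)) : tor_cycle z <-> (z <= tcycles F i)%MS.
  case: i z => [|i] z /=; first by rewrite submx1.
  by split=> [/sub_kermxP //|h]; apply/sub_kermxP.
have sub : (tdiff F i :&: tdeg F i j <= tcycles F i :&: tdeg F i j)%MS.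
  apply: capmxS => //; apply/row_subP => p; apply/cycE/(tor_boundary_cycle rF).
  by exists (delta_mx 0 p); rewrite rowE.
have degE m (A : 'M_(m, rk F i)) : (A <= tdeg F i j)%MS <-> A *m tdeg F i j = A.
  split=> [/submxP[B ->]|<-]; last exact: submxMl.
  by rewrite -mulmxA degree_mx_idem.
rewrite /homology_dim; split=> [/eqP|[z [zj zc zb]]].
  rewrite subn_eq0 (geq_leqif (mxrank_leqif_sup sub)) => /row_subPn[p].
  set z := row p _ => hz; exists z.
  have : (z <= tcycles F i :&: tdeg F i j)%MS by exact: row_sub.
  rewrite sub_capmx => /andP[/cycE zc zj]; split=> //; first exact/degE.
  case=> y zy; case/negP: hz; rewrite sub_capmx zj andbT zy; exact: submxMl.
move/eqP; rewrite subn_eq0 (geq_leqif (mxrank_leqif_sup sub)) => h.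
case: zb; have /submxP[y ->] : (z <= tdiff F i)%MS; last by exists y.
have : (z <= tcycles F i :&: tdeg F i j)%MS.
  by rewrite sub_capmx; apply/andP; split; [exact/cycE | exact/degE].
by move=> /submx_trans/(_ h); rewrite sub_capmx => /andP[].
Qed.

Section Lifting.
Variables (J' J : S -> Prop) (F' F : graded_free_seq K N) (f : S) (d : int).
Hypotheses (hJ : homogeneous_ideal J) (rF' : is_resolution J' F')
  (rF : is_resolution J F) (hf : ishom d f) (hmul : forall g, J' g -> J (g * f)).

(** Multiplication by [f] maps S/J' to S/J and lifts to the resolutions with a degree shift [d].
    With [f = 1] it compares two resolutions of one quotient; with J' = J : f it feeds the mapping
    cone. *)
Lemma lift_chain_map :
  exists phi : forall i, 'M[S]_(rk F' i, rk F i),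
  [/\ forall i, graded_mx (fun p => @sh _ _ F' i p + d) (@sh _ _ F i) (phi i),
      forall w : 'rV_(rk F' 0), J ((w *m aug F') 0 0 * f - (w *m phi 0%N *m aug F) 0 0)
    & forall i, diff F' i *m phi i = phi i.+1 *m diff F i].
Proof.
have [iJ hJh] := hJ.
pose T i := 'M[S]_(rk F' i, rk F i).
pose L (a : T 0%N) := forall w : 'rV_(rk F' 0), J ((w *m aug F') 0 0 * f - (w *m a *m aug F) 0 0).
(* The invariant: [a] is graded, the next square can be solved because its rows lie in the image of
   [diff F i], and at level 0 [a] agrees with the augmentations modulo [J]. *)
pose P i (a : T i) := [/\ graded_mx (fun p => @sh _ _ F' i p + d) (@sh _ _ F i) a,
  (forall p, exists w, row p (diff F' i *m a) = w *m diff F i) &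
  (match i return T i -> Prop with 0 => L | _ => fun=> True end) a].
pose R i (a : T i) (b : T i.+1) := diff F' i *m a = b *m diff F i.
have [|i a [ha ia La]|phi hphi] := @dependent_choice T P R.
- have /fin_all_exists[v hv] p : exists v : 'rV_(rk F 0), J (aug F' p 0 * f - (v *m aug F) 0 0).
    by case: rF => _ _ /(_ (aug F' p 0 * f)).
  pose A : T 0%N := \matrix_(p, q) hpart (sh p + d - sh q) (v p 0 q).
  have hA p : J (aug F' p 0 * f - (A *m aug F) p 0).
    have -> : (A *m aug F) p 0 = hpart (sh p + d) ((v p *m aug F) 0 0).
      rewrite !mxE raddf_sum /=; apply: eq_bigr => q _.
      by rewrite mxE (hpartM _ _ (res_aug_graded rF q)).
    rewrite -(hpart_id (ishomM (res_aug_graded rF' p) hf)) -raddfB /=.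
    exact: hJh.
  have LA : L A.
    move=> w; rewrite -mulmxA !mxE mulr_suml -sumrB; apply: ideal_sum => // p _.
    by rewrite -mulrA -mulrBr; case: iJ => _ _; apply; apply: hA.
  exists A; split=> //; first by move=> p q; rewrite mxE; apply: ishom_hpart.
  move=> p; case: (rF) => _ _ _ ex0 _; apply/ex0.
  have := LA (row p (diff F' 0)); rewrite row_mul => h.
  rewrite -[X in J X](subrK ((row p (diff F' 0) *m aug F') 0 0 * f)).
  case: (iJ) => _ JD _; apply: JD; first by rewrite -opprB; apply: ideal_opp.
  by apply: hmul; rewrite rowE; apply: res_diff_aug.
- have hb : graded_mx (fun p => @sh _ _ F' i.+1 p + d) (@sh _ _ F i) (diff F' i *m a).
    apply: graded_mxM ha => p q; have := res_diff_graded rF' i p q.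
    by congr ishom; ring.
  have [b [gb eb]] := lift_graded_mx (res_diff_graded rF i) hb ia.
  exists b; split=> //; split=> // p; apply: (res_exact rF).
  by rewrite -row_mul -mulmxA -eb mulmxA (res_diff_diff _ rF') mul0mx row0.
- exists phi; split=> [i||i]; try by case: (hphi i) => [[]].
  by case: (hphi 0%N) => [[]].
Qed.

End Lifting.

Section Homotopy.
Variables (J : S -> Prop) (F : graded_free_seq K N) (tau : forall i, 'M[S]_(rk F i)).
Hypotheses (rF : is_resolution J F)
  (tau0 : forall w : 'rV_(rk F 0), J ((w *m tau 0%N *m aug F) 0 0))
  (tauC : forall i, diff F i *m tau i = tau i.+1 *m diff F i).

(** A chain map inducing zero on S/J is homotopic to zero. The homotopy carries no grading, since
    [tor_boundary] asks for none. *)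
Lemma null_homotopy :
  exists h : forall i, 'M[S]_(rk F i, rk F i.+1),
    tau 0%N = h 0%N *m diff F 0 /\
    forall i, tau i.+1 = h i.+1 *m diff F i.+1 + diff F i *m h i.
Proof.
pose T i := 'M[S]_(rk F i, rk F i.+1).
pose L (a : T 0%N) := tau 0%N = a *m diff F 0.
(* The defect left after [a] is a cycle, so exactness supplies the next piece of the homotopy. *)
pose P i (a : T i) := (tau i.+1 - diff F i *m a) *m diff F i = 0 /\
  (match i return T i -> Prop with 0 => L | _ => fun=> True end) a.
pose R i (a : T i) (b : T i.+1) := tau i.+1 = b *m diff F i.+1 + diff F i *m a.
have [|i a [ia La]|h hh] := @dependent_choice T P R.
- have [a ea] : exists a, tau 0%N = a *m diff F 0.
    apply: lift_mx => p; case: (rF) => _ _ _ ex0 _; apply/ex0.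
    by rewrite rowE; apply: tau0.
  by exists a; split=> //; rewrite mulmxBl -mulmxA -ea tauC subrr.
- have [b eb] : exists b, tau i.+1 - diff F i *m a = b *m diff F i.+1.
    apply: lift_mx => p; apply: (res_exact rF).
    by rewrite -row_mul ia row0.
  have Rab : tau i.+1 = b *m diff F i.+1 + diff F i *m a by rewrite -eb subrK.
  exists b; split=> //; split=> //.
  rewrite mulmxBl -tauC {1}Rab mulmxDr !mulmxA (res_diff_diff _ rF) mul0mx addr0.
  by rewrite subrr.
- by exists h; split=> [|i]; [case: (hh 0%N) => [[]] | case: (hh i)].
Qed.

End Homotopy.

(** The comparison maps in both directions compose to a map homotopic to the identity, so [z] is
    recovered from its image up to a boundary. *)
Lemma tor_nonzero_transfer J F' F i j :
  homogeneous_ideal J -> is_resolution J F' -> is_resolution J F ->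
  tor_nonzero F' i j -> tor_nonzero F i j.
Proof.
move=> hJ rF' rF [z [zj zc zb]]; have [iJ _] := hJ.
have J1 g : J g -> J (g * 1) by rewrite mulr1.
have [phi [phig phi0 phiC]] := lift_chain_map hJ rF' rF (@ishom1 K N) J1.
have [psi [_ psi0 psiC]] := lift_chain_map hJ rF rF' (@ishom1 K N) J1.
pose tau i : 'M_(rk F' i) := phi i *m psi i - 1%:M.
have [|k|h [h0 hS]] := @null_homotopy J F' tau rF'.
- move=> w; rewrite mulmxBr mulmx1 mulmxBl mxE [X in _ + X]mxE -opprB.
  apply: ideal_opp => //; rewrite -[X in J X](subrKA ((w *m phi 0%N *m aug F) 0 0)).
  case: (iJ) => _ JD _; apply: JD; first by have := phi0 w; rewrite mulr1.
  by have := psi0 (w *m phi 0%N); rewrite mulr1 mulmxA.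
- by rewrite mulmxBr mulmxBl mulmx1 mul1mx mulmxA phiC -!mulmxA psiC.
exists (z *m red (phi i)); split.
- rewrite -mulmxA -/(degree_mx _ _) -(degree_mxC _ (phig i)) degree_mx_shift subr0.
  by rewrite mulmxA; congr (_ *m _).
- case: i z zj zc zb => // i z _ /= zc _.
  by rewrite -mulmxA /tdiff -map_mxM -phiC map_mxM mulmxA zc mul0mx.
case=> y hy; apply: zb.
have zpp : z *m red (phi i *m psi i) = y *m red (psi i.+1) *m tdiff F' i.
  by rewrite map_mxM mulmxA hy -!mulmxA /tdiff -!map_mxM psiC.
have ztau : z = z *m red (phi i *m psi i) - z *m red (tau i).
  by rewrite -mulmxBr -map_mxB opprB addrC subrK map_mx1 mulmx1.
(* As [z] is a cycle, the summand of the homotopy formula that begins with the differential kills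
   it, and [tau] sends it to a boundary. *)
rewrite ztau zpp; case: i z {zj} zc y {hy ztau zpp} => [|i] z zc y.
  by rewrite h0 map_mxM; eexists; rewrite mulmxA -mulmxBl.
rewrite hS map_mxD mulmxDr !map_mxM [X in _ - (_ + X)]mulmxA.
by move: zc => /= ->; rewrite mul0mx addr0 mulmxA; eexists; rewrite -mulmxBl.
Qed.

End Tor.

(** * Mapping cones and the long exact sequence *)

Section Cone.
Variables (K : fieldType) (N : nat).
Local Notation S := {mpoly K[N]}.
Local Notation red A := (map_mx (mcoeff 0%MM) A).
Variables (J : S -> Prop) (f : S) (d : int) (F' F : graded_free_seq K N).

Definition ideal_colon (g : S) := J (g * f).
Definition ideal_add (g : S) := exists h, J (g - h * f).

Variable phi : forall i, 'M[S]_(rk F' i, rk F i).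

Definition cone_rk i := match i with 0 => rk F 0 | i'.+1 => (rk F i'.+1 + rk F' i')%N end.

Definition cone_sh i : 'I_(cone_rk i) -> int :=
  match i with
  | 0 => @sh _ _ F 0
  | i'.+1 => fun p => match split p with inl a => sh a | inr b => sh b + d end
  end.

(** [F'] sits one step higher with degrees raised by [d]; the sign makes consecutive maps compose to
    zero. *)
Definition cone_diff i : 'M[S]_(cone_rk i.+1, cone_rk i) :=
  match i with
  | 0 => col_mx (diff F 0) (phi 0)
  | i'.+1 => block_mx (diff F i'.+1) 0 (phi i'.+1) (- diff F' i')
  end.

Definition cone := @GradedFreeSeq K N cone_rk cone_sh cone_diff (aug F).

Hypotheses (hJ : homogeneous_ideal J)
  (rF' : is_resolution ideal_colon F') (rF : is_resolution J F)
  (phig : forall i, graded_mx (fun p => @sh _ _ F' i p + d) (@sh _ _ F i) (phi i))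
  (phi0 : forall w : 'rV_(rk F' 0),
    J ((w *m aug F') 0 0 * f - (w *m phi 0%N *m aug F) 0 0))
  (phiC : forall i, diff F' i *m phi i = phi i.+1 *m diff F i).

Let iJ : ideal J. Proof. by case: hJ. Qed.

Lemma cone_is_resolution : is_resolution ideal_add cone.
Proof.
have [_ JD JM] := iJ.
split.
- case=> [|i] p q m /=.
    rewrite mxE /cone_sh; case: (split p) => a /=.
      by move/(res_diff_graded rF) ->; rewrite subrK.
    by move/phig ->; rewrite subrK.
  rewrite /cone_sh /block_mx !mxE; case: (split p) => a; rewrite mxE.
    case: (split q) => b; last by rewrite mxE msupp0.
    by move/(res_diff_graded rF) ->; rewrite subrK.
  case: (split q) => b; first by move/phig ->; rewrite subrK.
  rewrite mxE (perm_mem (msuppN _)) => /(res_diff_graded rF') ->; ring.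
- by case: rF.
- move=> g; case: (rF) => _ _ /(_ g)[v hv] _ _; exists v, 0.
  by rewrite mul0r subr0.
- move=> v; case: (rF) => _ _ _ ex0 _; split=> /= [[g hg]|[w ->]].
    case: (rF') => _ _ /(_ g)[v' hv'] _ _.
    have /ex0[w hw] : J (((v - v' *m phi 0%N) *m aug F) 0 0).
      rewrite mulmxBl mxE [X in _ + X]mxE.
      rewrite -(subrKA ((v' *m aug F') 0 0 * f)); apply: (JD) => //.
      rewrite -(subrKA (g * f)); apply: (JD) => //.
      by rewrite -mulrBl.
    by exists (row_mx w v'); rewrite mul_row_col -hw subrK.
  rewrite -[w]hsubmxK mul_row_col mulmxDl mxE.
  exists ((rsubmx w *m aug F') 0 0); rewrite -addrA; apply: (JD).
    exact: res_diff_aug.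
  by rewrite -opprB; apply: ideal_opp.
- case=> [|i] v /=; rewrite -[v]hsubmxK; move: (lsubmx v) (rsubmx v) => {v} a b.
    rewrite mul_row_col; split=> [h|[w]].
      (* The colon ideal enters here: the cycle condition puts [f] times the augmentation of [b]
         into [J], so [b] lifts along [diff F' 0]. This is the injectivity of multiplication by [f]
         on S/(J : f). *)
      have : ideal_colon ((b *m aug F') 0 0).
        rewrite /ideal_colon -[X in J X](subrK ((b *m phi 0%N *m aug F) 0 0)).
        apply: (JD) => //; rewrite -[b *m phi 0%N](addKr (a *m diff F 0)) h addr0.
        by rewrite mulNmx mxE; apply: ideal_opp => //; apply: res_diff_aug.
      case: (rF') => _ _ _ ex0' _ /ex0'[b' eb].
      have [|a' ea] := @res_exact _ _ _ _ _ (a + b' *m phi 1%N) rF.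
        by rewrite mulmxDl -mulmxA -phiC mulmxA -eb.
      exists (row_mx a' (- b')); rewrite mul_row_block !mulmx0 mulmxN !mulNmx opprK.
      by rewrite add0r -eb -ea addrK.
    rewrite -[w]hsubmxK mul_row_block => /eq_row_mx[-> ->].
    rewrite mulmx0 add0r mulmxDl -!mulmxA (res_diff_diff _ rF) mulmx0 add0r.
    by rewrite -phiC mulNmx mulmxN subrr.
  rewrite mul_row_block; split=> [|[w]].
    rewrite -row_mx0 => /eq_row_mx[h1]; rewrite mulmx0 add0r mulmxN => /eqP.
    rewrite oppr_eq0 => /eqP/(res_exact rF')[b' eb].
    have [|a' ea] := @res_exact _ _ _ _ _ (a + b' *m phi i.+2) rF.
      by rewrite mulmxDl -mulmxA -phiC mulmxA -eb.
    exists (row_mx a' (- b')); rewrite mul_row_block !mulmx0 mulmxN !mulNmx opprK.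
    by rewrite add0r -eb -ea addrK.
  rewrite -[w]hsubmxK mul_row_block => /eq_row_mx[-> ->].
  rewrite !mulmx0 !add0r mulmxDl -!mulmxA (res_diff_diff _ rF) mulmx0 add0r.
  rewrite -phiC !(mulmxN, mulNmx) opprK (res_diff_diff _ rF') mulmx0.
  by rewrite subrr row_mx0.
Qed.

Let pK i : 'M[K]_(rk F' i, rk F i) := red (phi i).

Lemma cone_cycle i (a : 'rV[K]_(rk F i.+1)) (b : 'rV[K]_(rk F' i)) :
  @tor_cycle K N cone i.+1 (row_mx a b) <->
  a *m tdiff F i + b *m pK i = 0 /\ tor_cycle b.
Proof.
case: i a b => [|i] a b /=.
  by rewrite /tdiff /= map_col_mx mul_row_col; split=> [|[]].
rewrite /tdiff /= map_block_mx mul_row_block map_mx0 map_mxN mulmx0 add0r mulmxN.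
rewrite -row_mx0; split=> [/eq_row_mx[-> /eqP]|[-> ->]]; last by rewrite oppr0.
by rewrite oppr_eq0 => /eqP.
Qed.

Lemma cone_boundary0 (a : 'rV[K]_(rk F 0)) :
  @tor_boundary K N cone 0 a <->
  exists u v, a = u *m tdiff F 0 + v *m pK 0.
Proof.
rewrite /tor_boundary /tdiff /= map_col_mx; split=> [[w ->]|[u [v ->]]].
  by rewrite -[w]hsubmxK mul_row_col; do 2!eexists.
by exists (row_mx u v); rewrite mul_row_col.
Qed.

Lemma cone_boundaryS i (a : 'rV[K]_(rk F i.+1)) (b : 'rV[K]_(rk F' i)) :
  @tor_boundary K N cone i.+1 (row_mx a b) <->
  exists u v, a = u *m tdiff F i.+1 + v *m pK i.+1 /\ b = - (v *m tdiff F' i).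
Proof.
rewrite /tor_boundary /tdiff /= map_block_mx map_mx0 map_mxN.
split=> [[w]|[u [v [-> ->]]]].
  rewrite -[w]hsubmxK mul_row_block mulmx0 add0r mulmxN => /eq_row_mx[-> ->].
  by do 2!eexists.
by exists (row_mx u v); rewrite mul_row_block mulmx0 add0r mulmxN.
Qed.

Lemma cone_tdeg i j (a : 'rV[K]_(rk F i.+1)) (b : 'rV[K]_(rk F' i)) :
  row_mx a b *m tdeg cone i.+1 j = row_mx (a *m tdeg F i.+1 j) (b *m tdeg F' i (j - d)).
Proof.
apply/rowP => p; rewrite mul_mx_diag !mxE /= -[p]splitK.
case: (split p) => k; rewrite unsplitK mul_mx_diag !mxE //.
by rewrite eq_sym -subr_eq eq_sym.
Qed.

Let pK_tdeg i j : tdeg F' i (j - d) *m pK i = pK i *m tdeg F i j.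
Proof. by have := degree_mxC j (@phig i); rewrite degree_mx_shift. Qed.

Let pKC i : tdiff F' i *m pK i = pK i.+1 *m tdiff F i.
Proof. by rewrite /tdiff -!map_mxM phiC. Qed.

(** Exactness at the cone: if Tor of [F'] vanishes there, [b] bounds some [c], and adding
    [c *m pK i.+1] to [a] gives a cycle of [F] representing the same class. *)
Lemma tor_cone i j : tor_nonzero cone i j ->
  tor_nonzero F i j \/ exists2 i', i = i'.+1 & tor_nonzero F' i' (j - d).
Proof.
case: i => [|i] [z [zj zc zb]].
  left; exists z; split=> // -[y zy]; apply: zb; apply/cone_boundary0.
  by exists y, 0; rewrite mul0mx addr0.
move: zj zc zb; rewrite -[z]hsubmxK; move: (lsubmx z) (rsubmx z) => {z} a b.
rewrite cone_tdeg => /eq_row_mx[aj bj] /cone_cycle[ab bc] zb.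
case: (classic (tor_nonzero F' i (j - d))) => [h|h]; [by right; exists i | left].
have := tor_zero_boundary rF' h bc; rewrite bj => /(tor_boundary_deg rF')/(_ bj)[c cj bE].
exists (a + c *m pK i.+1); split.
- by rewrite mulmxDl aj -mulmxA -pK_tdeg mulmxA cj.
- by rewrite /= mulmxDl -mulmxA -pKC mulmxA -bE.
case=> u hu; apply: zb; apply/cone_boundaryS; exists u, (- c).
by rewrite -hu !mulNmx opprK addrK.
Qed.

Let tor_cone_aux i j (a : 'rV[K]_(rk F i)) u (v : 'rV[K]_(rk F' i)) :
  a *m tdeg F i j = a -> a = u *m tdiff F i + v *m pK i -> tor_cycle v ->
  ~ tor_nonzero F' i (j - d) -> tor_boundary a.
Proof.
move=> aj av vc /(tor_zero_boundary rF')/(_ vc)[c hc].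
exists (u *m tdeg F i.+1 j + c *m pK i.+1).
rewrite mulmxDl -!mulmxA (tdeg_tdiff _ _ rF) -pKC !mulmxA -hc -aj av mulmxDl.
by congr (_ + _); rewrite -!mulmxA pK_tdeg.
Qed.

(** Exactness at S/J: if [a] bounds in the cone, it is a boundary of [F] plus the image of a cycle
    [v] of [F'], and the degree part of [v] bounds when Tor of [F'] vanishes there. *)
Lemma tor_base i j : tor_nonzero F i j ->
  tor_nonzero F' i (j - d) \/ tor_nonzero cone i j.
Proof.
move=> [a [aj ac ab]].
case: (classic (tor_nonzero F' i (j - d))) => h; [by left | right].
case: i a aj ac ab h => [|i] a aj ac ab h.
  exists a; split=> // /cone_boundary0[u [v auv]]; apply: ab.
  exact: (tor_cone_aux aj auv).
exists (row_mx a 0 : 'rV[K]_(rk cone i.+1)); split.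
- by rewrite cone_tdeg aj mul0mx.
- apply/cone_cycle; rewrite ac mul0mx addr0; split=> //.
  by case: i {a aj ac ab h} => //= i; rewrite mul0mx.
move/cone_boundaryS=> [u [v [auv /esym/eqP]]]; rewrite oppr_eq0 => /eqP vd.
by apply: ab; apply: (tor_cone_aux aj auv).
Qed.

(** Exactness at S/(J : f): if the image of [b] in [F] bounds [a], then the pair of [- a] and [b] is
    a cycle of the cone, one homological step higher. *)
Lemma tor_fiber i j : tor_nonzero F' i (j - d) ->
  tor_nonzero F i j \/ tor_nonzero cone i.+1 j.
Proof.
move=> [b [bj bc bb]].
case: (classic (tor_nonzero F i j)) => h; [by left | right].
have pc : tor_cycle (b *m pK i).
  by case: i b bj bc bb h => // i b _ /= bc _ _; rewrite -mulmxA -pKC mulmxA bc mul0mx.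
have pj : b *m pK i *m tdeg F i j = b *m pK i by rewrite -mulmxA -pK_tdeg mulmxA bj.
have := tor_zero_boundary rF h pc; rewrite pj => /(tor_boundary_deg rF)/(_ pj)[a aj ea].
exists (row_mx (- a) b : 'rV[K]_(rk cone i.+1)); split.
- by rewrite cone_tdeg mulNmx aj bj.
- by apply/cone_cycle; rewrite mulNmx -ea addNr.
move/cone_boundaryS=> [u [v [_ bv]]]; apply: bb; exists (- v).
by rewrite mulNmx.
Qed.

End Cone.

(** * Nonvanishing of Tor as a property of the ideal *)

Section TorIdeal.
Variables (K : fieldType) (N : nat).
Local Notation S := {mpoly K[N]}.
Implicit Types (J : S -> Prop).

Definition tor J i j := exists2 F, is_resolution J F & tor_nonzero F i j.

Lemma is_resolution_ext J J' (F : graded_free_seq K N) :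
  (forall g, J g <-> J' g) -> is_resolution J F -> is_resolution J' F.
Proof.
move=> e [h1 h2 h3 h4 h5]; split=> // [g|v].
  by have [v /e] := h3 g; exists v.
by split=> [/e/h4 | /h4/e].
Qed.

Lemma tor_ext J J' i j : (forall g, J g <-> J' g) -> tor J i j -> tor J' i j.
Proof. by move=> e [F /(is_resolution_ext e) rF tF]; exists F. Qed.

Lemma torP J F i j : homogeneous_ideal J -> is_resolution J F ->
  tor J i j <-> tor_nonzero F i j.
Proof.
move=> hJ rF; split=> [[F' rF']|]; last by exists F.
exact: tor_nonzero_transfer hJ rF' rF.
Qed.

Lemma betti_tor J i j : homogeneous_ideal J -> (exists F, is_resolution J F) ->
  betti J i j <> 0%N <-> tor J i j.
Proof.
move=> hJ ex; have rF : is_resolution J (resolution J) by apply: epsilon_spec.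
by rewrite (torP _ _ hJ rF); apply: homology_dim_neq0 rF.
Qed.

(** A class of degree [j] needs a basis vector of degree [j], and there are finitely many; the sum
    of absolute values is a convenient common bound. *)
Lemma tor_bounded J i : homogeneous_ideal J ->
  exists b : int, forall j, tor J i j -> j <= b.
Proof.
move=> hJ; case: (classic (exists F, is_resolution J F)) => [[F rF]|nF]; last first.
  by exists 0 => j [F rF]; case: nF; exists F.
exists (\sum_(p < rk F i) `|sh p|) => j /(torP _ _ hJ rF)[z [zj _ zb]].
have [p /eqP pj|no] := pickP (fun p : 'I_(rk F i) => sh p == j).
  rewrite (bigD1 p) //= -pj; apply: le_trans (ler_norm _) _.
  by rewrite lerDl sumr_ge0.
case: zb; exists 0; rewrite mul0mx -zj; apply/rowP => p.
by rewrite mul_mx_diag !mxE no mulr0.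
Qed.

Lemma tor_triple J J' J'' f d : homogeneous_ideal J -> ishom d f ->
  (exists F, is_resolution J F) -> (exists F, is_resolution J' F) ->
  homogeneous_ideal J' -> homogeneous_ideal J'' ->
  (forall g, J' g <-> J (g * f)) -> (forall g, J'' g <-> exists h, J (g - h * f)) ->
  forall i j,
  [/\ tor J'' i j -> tor J i j \/ exists2 i', i = i'.+1 & tor J' i' (j - d),
      tor J i j -> tor J' i (j - d) \/ tor J'' i j
    & tor J' i (j - d) -> tor J i j \/ tor J'' i.+1 j].
Proof.
move=> hJ hf [F rF] [F' rF'] hJ' hJ'' e' e'' i j.
have [phi [phig phi0 phiC]] := lift_chain_map hJ rF' rF hf (fun g => proj1 (e' g)).
have rF'2 : is_resolution (ideal_colon J f) F' := is_resolution_ext e' rF'.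
have rC := is_resolution_ext (fun g => iff_sym (e'' g))
  (cone_is_resolution hJ rF'2 rF phig phi0 phiC).
have tJ i1 j1 := @torP J F i1 j1 hJ rF.
have tJ' i1 j1 := @torP J' F' i1 j1 hJ' rF'.
have tJ'' i1 j1 := @torP J'' _ i1 j1 hJ'' rC.
split.
- move/tJ''/(tor_cone rF'2 phig phiC) => [/tJ|[i' ii' /tJ']]; first by left.
  by right; exists i'.
- by move/tJ/(tor_base rF'2 rF phig phiC) => [/tJ'|/tJ'']; [left | right].
- by move/tJ'/(tor_fiber rF phig phiC) => [/tJ|/tJ'']; [left | right].
Qed.

End TorIdeal.

(** * Existence of graded resolutions *)

(** Dickson's lemma on the first [n] exponents, read off by [e] from arbitrary objects so that it
    selects polynomials rather than monomials. *)
Lemma dickson (T : eqType) (e : T -> nat -> nat) n (P : T -> Prop) :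
  exists2 s : seq T, forall t, t \in s -> P t &
    forall t, P t -> exists2 u, u \in s & forall k, (k < n)%N -> (e u k <= e t k)%N.
Proof.
elim: n P => [|n IHn] P.
  case: (classic (exists t, P t)) => [[t Pt]|no]; last first.
    by exists [::] => // t Pt; case: no; exists t.
  by exists [:: t] => [u|u _]; [rewrite inE => /eqP-> | exists t; rewrite ?mem_head].
(* [C] bounds the last exponent on [s0]. An element whose last exponent is at least [C] is dominated
   by [s0]; each of the finitely many smaller values is handled by induction. *)
have [s0 s0P s0dom] := IHn P; pose C := (\sum_(u <- s0) e u n)%N.
have /fin_all_exists2[s sP sdom] (c : 'I_C) := IHn (fun t => P t /\ e t n = c).
exists (s0 ++ flatten [seq s c | c : 'I_C]) => t.
  rewrite mem_cat => /orP[/s0P //|/flattenP[_ /mapP[c _ ->]]].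
  by move=> /sP[].
move=> Pt; case: (leqP C (e t n)) => tC.
  have [u us0 ut] := s0dom t Pt; exists u; first by rewrite mem_cat us0.
  move=> k; rewrite ltnS leq_eqVlt => /orP[/eqP->|/ut //].
  by apply: leq_trans tC; rewrite /C (big_rem u us0) leq_addr.
have [u us ut] := sdom (Ordinal tC) t (conj Pt (erefl _)); exists u.
  rewrite mem_cat; apply/orP; right; apply/flattenP.
  by exists (s (Ordinal tC)) => //; exact: codom_f.
move=> k; rewrite ltnS leq_eqVlt => /orP[/eqP->|/ut //].
by have [_ ->] := sP _ _ us.
Qed.

Section Span.
Variables (R : comNzRingType) (V : lmodType R).
Implicit Types (s : seq V) (v : V) (U : V -> Prop).

Definition submodule U :=
  [/\ U 0, forall u v, U u -> U v -> U (u + v) & forall a v, U v -> U (a *: v)].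

(** Peeling off one generator at a time makes the ideal of [f :: s] convertible to
    [ideal_add (idl s) f], the ideal resolved by the mapping cone. *)
Fixpoint span s v : Prop :=
  if s is g :: s' then exists h, span s' (v - h *: g) else v = 0.

Lemma span_submodule s : submodule (span s).
Proof.
elim: s => [|g s [s0 sD sZ]] /=.
  by split=> [//|u v -> ->|a v ->]; rewrite ?addr0 ?scaler0.
split=> [|u v [h hu] [k kv]|a v [h hv]]; first by exists 0; rewrite scale0r subr0.
  by exists (h + k); rewrite scalerDl opprD addrACA; apply: sD.
by exists (a * h); rewrite -scalerA -scalerBr; apply: sZ.
Qed.

Lemma span_mem s v : v \in s -> span s v.
Proof.
elim: s => //= g s IHs; rewrite inE => /orP[/eqP->|/IHs sv].
  by exists 1; rewrite scale1r subrr; case: (span_submodule s).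
by exists 0; rewrite scale0r subr0.
Qed.

Lemma span_min s U v : submodule U -> (forall g, g \in s -> U g) -> span s v -> U v.
Proof.
move=> sU; case: (sU) => U0 UD UZ; elim: s v => [|g s IHs] v sub /=; first by move->.
case=> h sv; rewrite -(subrK (h *: g) v); apply: (UD).
  by apply: IHs sv => k ks; apply: sub; rewrite inE ks orbT.
by apply/UZ/sub/mem_head.
Qed.

End Span.

Section Noetherian.
Variables (K : fieldType) (N : nat).
Local Notation S := {mpoly K[N]}.
Implicit Types (J : S -> Prop) (f g p q r : S).

Definition idl (s : seq S) : S -> Prop := @span S S^o s.

Lemma idl_ideal s : ideal (idl s).
Proof. exact: (@span_submodule S S^o s). Qed.

Lemma idl_mem s g : g \in s -> idl s g.
Proof. exact: (@span_mem S S^o s). Qed.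

Lemma idl_min s J p : ideal J -> (forall g, g \in s -> J g) -> idl s p -> J p.
Proof. exact: (@span_min S S^o s J p). Qed.

Lemma mlead_cancel p q : mlead p = mlead q -> mleadc p = mleadc q -> p - q != 0 ->
  (mlead (p - q) < mlead p)%O.
Proof.
move=> e1 e2 nz; rewrite lt_neqAle; apply/andP; split; last first.
  by have := mleadB_le p q; rewrite -e1 joinxx.
apply: contra_neq nz => e; apply/eqP; rewrite -mleadc_eq0 e mcoeffB e2 e1.
by rewrite subrr.
Qed.

(** Division on leading terms only: it stops once the leading monomial of the remainder is
    irreducible. *)
Lemma reduce_by J (G : seq S) : ideal J -> (forall g, g \in G -> J g /\ g != 0) ->
  forall p, exists r, J (p - r) /\
    (r = 0 \/ forall g, g \in G -> ~~ (mlead g <= mlead r)%MM).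
Proof.
move=> iJ GJ; elim/mleadrect=> p IHp; have [J0 JD JM] := iJ.
have [->|p0] := eqVneq p 0; first by exists 0; rewrite subrr; split=> //; left.
have [/hasP[g gG gp]|/hasPn no] := boolP (has (fun g => mlead g <= mlead p)%MM G); last first.
  by exists p; rewrite subrr; split=> //; right.
have [Jg g0] := GJ g gG.
(* [h] is the multiple of [g] with the same leading term as [p]. *)
pose c := mleadc p / mleadc g; pose h := c *: 'X_[mlead p - mlead g] * g.
have c0 : c != 0 by rewrite mulf_eq0 invr_eq0 !mleadc_eq0 negb_or p0.
have X0 : c *: 'X_[mlead p - mlead g] != 0 :> S.
  by rewrite -mleadc_eq0 mleadcZE mleadXm mcoeffX eqxx mulr1.
have hl : mlead h = mlead p by rewrite mleadM // mleadZ // mleadXm submK.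
have hc : mleadc h = mleadc p.
  rewrite /h mleadM // mleadcM mleadcZE mleadXm mcoeffX eqxx mulr1.
  by rewrite divfK ?mleadc_eq0.
have [ph|ph] := eqVneq (p - h) 0.
  exists 0; rewrite subr0; split; last by left.
  by rewrite -(subrK h p) ph add0r; apply: JM.
have [r [Jr rP]] := IHp _ (mlead_cancel (esym hl) (esym hc) ph).
exists r; split=> //; rewrite -(subrK h p) addrAC; apply: (JD) => //; exact: JM.
Qed.

(** Gordan's argument: finitely many elements of [J] have leading monomials dividing those of all
    others, and a remainder, being in [J], must vanish. *)
Lemma ideal_fg J : ideal J -> exists s, forall p, J p <-> idl s p.
Proof.
move=> iJ; pose e p k := if insub k is Some i then mlead p i else 0%N.
have [s sP sdom] := dickson e N (fun p => J p /\ p != 0).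
have sub p : idl s p -> J p by apply: idl_min => // g /sP[].
exists s => p; split=> [Jp|]; last exact: sub.
have [|r [sr rP]] := reduce_by (idl_ideal s) (G := s) _ p.
  by move=> g gs; split; [exact: idl_mem | case: (sP g gs)].
suff r0 : r = 0 by rewrite r0 subr0 in sr.
case: rP => // rP; apply/eqP; apply: contraT => rn0.
have Jr : J r by rewrite -(subKr p r); apply: ideal_sub => //; apply: sub.
have [g gs gr] := sdom r (conj Jr rn0).
case/negP: (rP g gs); apply/mnm_lepP => i.
by have := gr i (ltn_ord i); rewrite /e valK.
Qed.

(** Induction on the rank: the first coordinates of [U] form an ideal, whose generators lift to
    [s1], and the vectors of [U] with first coordinate 0 live in rank [k]. *)
Lemma submodule_fg k (U : 'rV[S]_k -> Prop) : submodule U ->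
  exists s, forall v, U v <-> span s v.
Proof.
elim: k U => [|k IHk] U sU; have [U0 UD UZ] := sU.
  by exists [::] => v; split=> [_|->] //; apply/rowP => -[].
have UB u v : U u -> U v -> U (u - v).
  by move=> Uu Uv; apply: (UD) => //; rewrite -scaleN1r; apply: UZ.
have [G hG] : exists G, forall f, (exists2 v, U v & v 0 0 = f) <-> idl G f.
  apply: ideal_fg; split; first by exists 0; rewrite ?mxE.
    by move=> _ _ [u Uu <-] [v Uv <-]; exists (u + v); rewrite ?mxE //; apply: (UD).
  by move=> a _ [v Uv <-]; exists (a *: v); rewrite ?mxE //; apply: UZ.
have [s1 s1U s1G] : exists2 s1 : seq 'rV_k.+1, forall v, v \in s1 -> U v &
    [seq v 0 0 | v : 'rV[S]_k.+1 <- s1] = G.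
  have: forall g, g \in G -> exists2 v, U v & v 0 0 = g by move=> g /idl_mem/hG.
  elim: (G) => [|g G' IHG] GP; first by exists [::].
  have [|s1 s1U <-] := IHG; first by move=> h hG'; apply: GP; rewrite inE hG' orbT.
  have [v Uv <-] := GP g (mem_head _ _).
  by exists (v :: s1) => // w; rewrite inE => /orP[/eqP-> //|/s1U].
have s1span f : idl G f -> exists2 u, span s1 u & u 0 0 = f.
  rewrite -s1G; elim: (s1) f => [|v s IHs] f /=; first by move->; exists 0; rewrite ?mxE.
  case=> h /IHs[u su uf]; exists (u + h *: v); first by exists h; rewrite addrK.
  by rewrite !mxE uf [_ *: _]/(_ * _) subrK.
pose inj v : 'rV[S]_k.+1 := row_mx (0 : 'rV_1) v.
have injD x y : inj (x + y) = inj x + inj y by rewrite [RHS](@add_row_mx _ 1 1 k) addr0.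
have injZ a x : inj (a *: x) = a *: inj x by rewrite [RHS](@scale_row_mx _ 1 1 k) scaler0.
have inj0 : inj 0 = 0 by rewrite /inj row_mx0.
have [|s2 hs2] := IHk (fun v => U (inj v)).
  split=> [|u v Uu Uv|a v Uv]; first by rewrite inj0.
    by rewrite injD; apply: (UD).
  by rewrite injZ; apply: UZ.
exists (s1 ++ [seq inj v | v <- s2]) => v; have sS := span_submodule (s1 ++ [seq inj v | v <- s2]).
split=> [Uv|]; last first.
  apply: span_min => // g; rewrite mem_cat => /orP[/s1U //|/mapP[w ws ->]].
  exact/hs2/span_mem.
case: (sS) => S0 SD SZ.
have [u su uv] : exists2 u, span s1 u & u 0 0 = v 0 0.
  by apply/s1span/hG; exists v.
have Uu : U u by apply: span_min su.
rewrite -(subrK u v); apply: (SD); last first.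
  by apply: span_min su => // g gs; apply: span_mem; rewrite mem_cat gs.
have injK (x : 'rV[S]_k.+1) : x 0 0 = 0 -> x = inj (rsubmx (x : 'rV_(1 + k))).
  move=> x0; rewrite /inj -[LHS](@hsubmxK _ 1 1 k).
  suff -> : lsubmx (x : 'rV_(1 + k)) = 0 :> 'rV_1 by [].
  by apply/rowP => i; rewrite ord1 !mxE -x0; congr (x _ _); apply/val_inj.
have vu : (v - u) 0 0 = 0 by rewrite !mxE uv subrr.
have := UB _ _ Uv Uu; rewrite (injK _ vu) => /hs2 sw.
apply: (@span_min _ _ s2 (fun w => span _ (inj w))) sw.
  split=> [|x y sx sy|a x sx]; first by rewrite inj0.
    by rewrite injD; apply: (SD).
  by rewrite injZ; apply: SZ.
move=> g gs; apply: span_mem; rewrite mem_cat; apply/orP; right; exact: map_f.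
Qed.

Definition vpart k (t : 'I_k -> int) e (v : 'rV[S]_k) : 'rV[S]_k :=
  \row_q hpart (e - t q) (v 0 q).

Definition vdegrees k (t : 'I_k -> int) (v : 'rV[S]_k) : seq int :=
  undup (flatten [seq [seq (mdeg m)%:Z + t q | m <- msupp (v 0 q)] | q : 'I_k]).

Lemma vpart_sum k (t : 'I_k -> int) (v : 'rV[S]_k) :
  v = \sum_(e <- vdegrees t v) vpart t e v.
Proof.
apply/rowP => q; apply/mpolyP => m; rewrite summxE raddf_sum /=.
under eq_bigr do rewrite mxE mcoeff_hpart.
case: (boolP (m \in msupp (v 0 q))) => mv; last first.
  by rewrite (memN_msupp_eq0 mv) big1 // => e _; rewrite if_same.
rewrite (bigD1_seq ((mdeg m)%:Z + t q)) ?undup_uniq //=; last first.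
  rewrite mem_undup; apply/flattenP; eexists; first by apply/mapP; exists q; rewrite ?mem_enum.
  exact: map_f.
rewrite addrK eqxx big1 ?addr0 // => e /negbTE ne.
by rewrite eq_sym subr_eq ne.
Qed.

(** The homogeneous components of finitely many generators still lie in [U] and generate it. *)
Lemma graded_submodule_fg k (t : 'I_k -> int) (U : 'rV[S]_k -> Prop) :
  submodule U -> (forall e v, U v -> U (vpart t e v)) ->
  exists c (s : 'I_c -> int) (D : 'M[S]_(c, k)),
    graded_mx s t D /\ forall v, U v <-> exists w, v = w *m D.
Proof.
move=> sU Uh; have [s hs] := submodule_fg sU.
pose l : seq (int * 'rV[S]_k) := flatten [seq [seq (e, vpart t e v) | e <- vdegrees t v] | v <- s].
have lP (x : int * 'rV[S]_k) : x \in l -> U x.2 /\ forall q : 'I_k, ishom (x.1 - t q) (x.2 0 q).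
  move=> /flattenP[_ /mapP[v vs ->] /mapP[e _ ->]] /=; split.
    by apply/Uh/hs/span_mem.
  by move=> q; rewrite mxE; apply: ishom_hpart.
pose D : 'M[S]_(size l, k) := \matrix_i (nth (0, 0) l i).2.
exists (size l), (fun i => (nth (0, 0) l i).1), D; split.
  by move=> p q; rewrite mxE; apply: (lP _ (mem_nth _ (ltn_ord p))).2.
have [U0 UD UZ] := sU.
move=> v; split=> [/hs sv|[w ->]]; last first.
  rewrite mulmx_sum_row; elim/big_rec: _ => // i x _ Ux; apply: (UD) => //.
  by apply: UZ; rewrite rowK; apply: (lP _ (mem_nth _ (ltn_ord i))).1.
apply: (@span_min _ _ s (fun v => exists w, v = w *m D) v _ _ sv) => [|g gs].
  split=> [|_ _ [u ->] [w ->]|a _ [w ->]]; first by exists 0; rewrite mul0mx.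
    by exists (u + w); rewrite mulmxDl.
  by exists (a *: w); rewrite scalemxAl.
rewrite (vpart_sum t g) big_seq_cond.
elim/big_rec: _ => [|e x /andP[eg _] [w ->]]; first by exists 0; rewrite mul0mx.
have el : (e, vpart t e g) \in l.
  apply/flattenP; exists [seq (e, vpart t e g) | e <- vdegrees t g].
    by apply/mapP; exists g.
  exact: (map_f (fun e => (e, vpart t e g))).
have il : (index (e, vpart t e g) l < size l)%N by rewrite index_mem.
exists (delta_mx 0 (Ordinal il) + w); rewrite mulmxDl -rowE rowK /=.
by rewrite nth_index.
Qed.

Record syzygies a b (t : 'I_b -> int) (D : 'M[S]_(b, a)) := Syzygies {
  syz_rk : nat;
  syz_sh : 'I_syz_rk -> int;
  syz_mx : 'M[S]_(syz_rk, b);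
  syz_graded : graded_mx syz_sh t syz_mx;
  syz_exact : forall v : 'rV_b, v *m D = 0 <-> exists w, v = w *m syz_mx }.
Arguments syz_graded {a b t D} s.
Arguments syz_exact {a b t D} s v.

Lemma syzygies_exist a b (s : 'I_a -> int) (t : 'I_b -> int) (D : 'M[S]_(b, a)) :
  graded_mx t s D -> inhabited (syzygies t D).
Proof.
move=> gD; have [||c [u [E [gE hE]]]] := @graded_submodule_fg b t (fun v => v *m D = 0).
- split=> [|x y hx hy|x y hy]; first exact: mul0mx.
    by rewrite mulmxDl hx hy addr0.
  by rewrite -scalemxAl hy scaler0.
- move=> e v vD; apply/rowP => r; rewrite !mxE.
  have := congr1 (fun w : 'rV_a => hpart (e - s r) (w 0 r)) vD.
  rewrite !mxE !raddf0 raddf_sum /= => h; apply: etrans h; apply: eq_bigr => q _.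
  rewrite mxE (hpartM _ _ (gD q r)); congr (hpart _ _ * _); ring.
- by constructor; exists c u E.
Qed.

(** Bundling a matrix with its shifts makes the syzygy construction iterable; the target of
    [next_step X] is the source of [X] by conversion, so successive matrices compose without
    casts. *)
Record graded_step := GradedStep {
  src : nat; src_sh : 'I_src -> int;
  tgt : nat; tgt_sh : 'I_tgt -> int;
  step_mx : 'M[S]_(src, tgt);
  step_graded : graded_mx src_sh tgt_sh step_mx }.
Arguments step_graded : clear implicits.

Definition step_syz (X : graded_step) : syzygies (@src_sh X) (step_mx X) :=
  epsilon (syzygies_exist (step_graded X)) (fun=> True).

Definition next_step (X : graded_step) : graded_step :=
  GradedStep (syz_graded (step_syz X)).

Lemma resolution_exists J : homogeneous_ideal J -> exists F, is_resolution J F.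
Proof.
move=> [iJ Jh]; have [J0 JD JM] := iJ.
have [||c [s [D [gD hD]]]] := @graded_submodule_fg 1 (fun=> 0) (fun v => J (v 0 0)).
- split=> [|u v|a v]; rewrite !mxE //; first exact: JD.
  exact: JM.
- by move=> e v Jv; rewrite mxE; apply: Jh.
(* The resolution starts with S itself and augmentation 1; [D] maps onto [J], and each later matrix
   maps onto the syzygies of the previous one. *)
pose st i := iter i next_step (GradedStep gD).
exists (@GradedFreeSeq K N (fun i => tgt (st i)) (fun i => @tgt_sh (st i))
  (fun i => step_mx (st i)) 1%:M); split=> /=.
- by move=> i p q m /(step_graded (st i)) ->; rewrite subrK.
- by move=> p m; rewrite !ord1 mxE eqxx => /ishom1.
- by move=> f; exists f%:M; rewrite mulmx1 mxE eqxx subrr.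
- by move=> v; rewrite mulmx1; apply: hD.
- move=> i v; exact: syz_exact (step_syz (st i)) v.
Qed.

End Noetherian.

(** * Regularity of complete intersections *)

Section Regularity.
Variables (K : fieldType) (N : nat).
Local Notation S := {mpoly K[N]}.
Implicit Types (J : S -> Prop) (f g p q r : S).

Lemma homogeneous_ideal_ext J J' :
  (forall g, J g <-> J' g) -> homogeneous_ideal J -> homogeneous_ideal J'.
Proof.
move=> e [[J0 JD JM] Jh]; split; last by move=> k p /e/(Jh k)/e.
split=> [|p q /e Jp /e Jq|p q /e Jq]; apply/e => //; [exact: JD | exact: JM].
Qed.

Lemma homogeneous_colon J f d : homogeneous_ideal J -> ishom d f ->
  homogeneous_ideal (ideal_colon J f).
Proof.
move=> [[J0 JD JM] Jh] hf; rewrite /ideal_colon; split; first split.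
- by rewrite mul0r.
- by move=> p q Jp Jq; rewrite mulrDl; apply: JD.
- by move=> p q Jq; rewrite -mulrA; apply: JM.
- by move=> e p /(Jh (e + d)); rewrite (hpartM _ _ hf) addrK.
Qed.

Lemma homogeneous_add J f d : homogeneous_ideal J -> ishom d f ->
  homogeneous_ideal (ideal_add J f).
Proof.
move=> [[J0 JD JM] Jh] hf; rewrite /ideal_add; split; first split.
- by exists 0; rewrite mul0r subr0.
- by move=> p q [h Jp] [k Jq]; exists (h + k); rewrite mulrDl opprD addrACA; apply: JD.
- by move=> p q [h Jq]; exists (p * h); rewrite -mulrA -mulrBr; apply: JM.
- move=> e p [h /(Jh e)]; rewrite raddfB /= (hpartM _ _ hf) => Jp.
  by exists (hpart (e - d) h).
Qed.

Lemma tor_les J J' J'' f d : homogeneous_ideal J -> ishom d f ->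
  (forall g, J' g <-> J (g * f)) -> (forall g, J'' g <-> exists h, J (g - h * f)) ->
  forall i j,
  [/\ tor J'' i j -> tor J i j \/ exists2 i', i = i'.+1 & tor J' i' (j - d),
      tor J i j -> tor J' i (j - d) \/ tor J'' i j
    & tor J' i (j - d) -> tor J i j \/ tor J'' i.+1 j].
Proof.
move=> hJ hf e' e''.
have hJ' : homogeneous_ideal J'.
  by apply: homogeneous_ideal_ext (homogeneous_colon hJ hf) => g; apply: iff_sym.
have hJ'' : homogeneous_ideal J''.
  by apply: homogeneous_ideal_ext (homogeneous_add hJ hf) => g; apply: iff_sym.
by apply: (@tor_triple _ _ J J' J'' f d) => //; apply: resolution_exists.
Qed.

Definition reg_le J (rho : int) := forall i j, tor J i j -> j - i%:Z <= rho.

(** Regularity of [f] gives J : f = J. A class on the extremal diagonal is pushed by the shift to j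
    - i = [rho + d], where Tor of S/J vanishes, so it comes from one step higher over S/J''. *)
Lemma reg_add_regular J J'' f d rho t : homogeneous_ideal J -> ishom d f -> 1 <= d ->
  (forall g, J (g * f) -> J g) -> (forall g, J'' g <-> exists h, J (g - h * f)) ->
  reg_le J rho -> tor J t (t%:Z + rho) ->
  reg_le J'' (rho + (d - 1)) /\ tor J'' t.+1 (t.+1%:Z + (rho + (d - 1))).
Proof.
move=> hJ hf d1 reg e'' rJ tJ; have [[_ _ JM] _] := hJ.
have e' g : J g <-> J (g * f) by split=> [Jg|/reg //]; rewrite mulrC; apply: JM.
have les := tor_les hJ hf e' e''; split.
  move=> i j; have [h _ _] := les i j; move/h => [/rJ|[i' -> /rJ]]; lia.
have tj : t%:Z + rho = (t.+1%:Z + (rho + (d - 1))) - d by lia.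
case: (les t (t.+1%:Z + (rho + (d - 1)))) => _ _; rewrite -tj => /(_ tJ)[/rJ|//]; lia.
Qed.

Definition zero_resolution : graded_free_seq K N :=
  @GradedFreeSeq K N (fun i => (i == 0)%N) (fun _ _ => 0) (fun=> 0) (const_mx 1).

Lemma zero_resolutionP : is_resolution (fun p : S => p = 0) zero_resolution.
Proof.
split=> /=.
- by move=> i [].
- by move=> p m; rewrite mxE => /ishom1.
- by move=> f; exists f%:M; rewrite mul_scalar_mx !mxE mulr1 subrr.
- move=> v; split=> [h|[w ->]]; last by rewrite mulmx0 mul0mx mxE.
  exists 0; rewrite mul0mx; apply/rowP => i; rewrite ord1.
  by move: h; rewrite mxE big_ord1 !mxE mulr1.
- move=> i v; split=> _; first by exists 0; apply/rowP => -[].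
  by apply/eqP; rewrite mulmx0.
Qed.

Lemma homogeneous_zero : homogeneous_ideal (fun p : S => p = 0).
Proof.
split; last by move=> e p ->; rewrite raddf0.
by split=> [//|p q -> ->|p q ->]; rewrite ?addr0 ?mulr0.
Qed.

Lemma tor_zero : reg_le (fun p : S => p = 0) 0 /\ tor (fun p : S => p = 0) 0 0.
Proof.
have tE i j := @torP _ _ _ _ i j homogeneous_zero zero_resolutionP.
split=> [i j /tE [z [zj _ zb]]|].
  case: i z zj zb => [|i] z zj zb; last by case: zb; exists 0; apply/rowP => -[].
  case: (eqVneq 0 j) => [<-|j0]; first by rewrite subr0.
  case: zb; exists 0; rewrite mul0mx -zj; apply/rowP => p.
  by rewrite mul_mx_diag !mxE /= (negbTE j0) mulr0.
apply/tE; exists (const_mx 1); split=> //.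
  by apply/rowP => p; rewrite mul_mx_diag !mxE eqxx mulr1.
case=> y /rowP/(_ ord0); rewrite /tdiff /= map_mx0 mulmx0 !mxE => /eqP.
by rewrite oner_eq0.
Qed.

Definition mcoprime (m1 m2 : 'X_{1..N}) := [forall i, (m1 i == 0%N) || (m2 i == 0%N)].

Lemma mcoprime_dvd (m1 m2 m : 'X_{1..N}) :
  mcoprime m1 m2 -> (m1 <= m + m2)%MM -> (m1 <= m)%MM.
Proof.
move=> /forallP co /mnm_lepP le; apply/mnm_lepP => i.
have := le i; rewrite mnmDE; case/orP: (co i) => /eqP->; rewrite ?addn0 //.
Qed.

Lemma idl_homogeneous s : (forall f, f \in s -> exists d, ishom d f) ->
  homogeneous_ideal (idl s).
Proof.
move=> hs; split; first exact: idl_ideal.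
elim: s hs => [|f s IHs] hs e p /=; first by move->; rewrite raddf0.
have [d hf] := hs f (mem_head _ _); case=> h hp; exists (hpart (e - d) h).
have := IHs _ e _ hp; rewrite raddfB /= [h *: _]/(h * f) (hpartM _ _ hf).
by apply=> g gs; apply: hs; rewrite inE gs orbT.
Qed.

(** [s] is a Groebner basis of its ideal for the order of [mlead]. *)
Definition lead_generated (s : seq S) :=
  forall p, idl s p -> p != 0 -> exists2 f, f \in s & (mlead f <= mlead p)%MM.

Section CoprimeLead.
Variables (s : seq S) (f : S).
Hypotheses (gb : lead_generated s) (s0 : forall g, g \in s -> g != 0) (f0 : f != 0)
  (cop : forall g, g \in s -> mcoprime (mlead g) (mlead f)).

Let red h : exists r, idl s (h - r) /\
  (r = 0 \/ forall g, g \in s -> ~~ (mlead g <= mlead r)%MM).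
Proof.
apply: reduce_by; first exact: idl_ideal.
by move=> g gs; split; [exact: idl_mem | exact: s0].
Qed.

Let nodiv r g : (forall g, g \in s -> ~~ (mlead g <= mlead r)%MM) -> g \in s ->
  r != 0 -> ~~ (mlead g <= mlead (r * f))%MM.
Proof.
move=> rP gs r0; rewrite mleadM //; apply: contra (rP g gs).
by apply: mcoprime_dvd; apply: cop.
Qed.

(** Replace [h] by its remainder [r]. If [r] is nonzero, some leading monomial of [s] divides that
    of [r * f], hence that of [r] by coprimality, a contradiction. *)
Lemma coprime_lead_regular h : idl s (h * f) -> idl s h.
Proof.
have iJ := idl_ideal s; move=> hf; have [r [hr rP]] := red h.
suff r0 : r = 0 by rewrite r0 subr0 in hr.
case: rP => // rP; apply/eqP; apply: contraT => r0.
have rf : idl s (r * f).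
  rewrite -(subKr (h * f) (r * f)) -mulrBl; apply: ideal_sub => //.
  exact: (ideal_mulr _ iJ hr).
have [|g gs gr] := gb rf; first by rewrite mulf_neq0.
by case/negP: (nodiv rP gs r0).
Qed.

(** Write [p] as an element of the old ideal plus [r * f] with [r] reduced. Their leading monomials
    differ, since that of [r * f] is irreducible, so the larger one leads [p]. *)
Lemma coprime_lead_generated : lead_generated (f :: s).
Proof.
have iJ := idl_ideal s.
move=> p [h]; rewrite [h *: _]/(h * f) => hp p0.
have [r [hr rP]] := red h.
have {hp} hp : idl s (p - r * f).
  have -> : p - r * f = (p - h * f) + (h - r) * f by ring.
  by case: (iJ) => _ JD _; apply: (JD) => //; exact: (ideal_mulr _ iJ hr).
case: (eqVneq r 0) hp => [->|r0].
  rewrite mul0r subr0 => /gb/(_ p0)[g gs gp]; exists g => //.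
  by rewrite inE gs orbT.
case: rP => [/eqP|rP]; first by rewrite (negbTE r0).
have [/eqP|q0] := eqVneq (p - r * f) 0.
  by rewrite subr_eq0 => /eqP-> _; exists f; rewrite ?mem_head // mleadM // lem_addl.
move=> /gb/(_ q0)[g gs gq].
have ne : mlead (p - r * f) != mlead (r * f).
  by apply/eqP => e; case/negP: (nodiv rP gs r0); rewrite -e.
have := mleadD ne; rewrite subrK => ->.
case: (leP (mlead (p - r * f)) (mlead (r * f))) => _.
  by exists f; rewrite ?mem_head // mleadM // lem_addl.
by exists g; rewrite ?inE ?gs ?orbT.
Qed.

End CoprimeLead.

(** Each generator is regular modulo the later ones and adds its degree minus one to the regularity;
    the tracked class sits at position [size s], the last of the Koszul complex. *)
Lemma coprime_lead_tor (s : seq S) :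
  (forall f, f \in s ->
     [/\ f != 0, ishom (mdeg (mlead f))%:Z f & (0 < mdeg (mlead f))%N]) ->
  pairwise (fun f g => mcoprime (mlead g) (mlead f)) s ->
  let rho := (\sum_(f <- s) (mdeg (mlead f)).-1)%N in
  [/\ lead_generated s, reg_le (idl s) rho & tor (idl s) (size s) (size s + rho)%N].
Proof.
elim: s => [|f s IHs] hs /=.
  move=> _; rewrite big_nil addn0; have [r0 t0] := tor_zero.
  by split=> // p ->; rewrite eqxx.
move=> /andP[/allP cof cos].
have [f0 hf df] := hs f (mem_head _ _).
have hs' g : g \in s -> [/\ g != 0, ishom (mdeg (mlead g))%:Z g & (0 < mdeg (mlead g))%N].
  by move=> gs; apply: hs; rewrite inE gs orbT.
have [gb reg tr] := IHs hs' cos.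
have s0 g : g \in s -> g != 0 by case/hs'.
have hI : homogeneous_ideal (idl s).
  by apply: idl_homogeneous => g /hs'[_ hg _]; eexists; exact: hg.
have d1 : 1 <= (mdeg (mlead f))%:Z by [].
have add p : idl (f :: s) p <-> exists h, idl s (p - h * f) by [].
rewrite PoszD in tr.
have [rg tg] := reg_add_regular hI hf d1 (coprime_lead_regular gb s0 f0 cof) add reg tr.
have dE : ((mdeg (mlead f)).-1 + \sum_(f <- s) (mdeg (mlead f)).-1)%N%:Z =
    (\sum_(f <- s) (mdeg (mlead f)).-1)%N%:Z + ((mdeg (mlead f))%:Z - 1) by lia.
split; first exact: coprime_lead_generated.
- by rewrite big_cons dE.
- by rewrite big_cons PoszD dE.
Qed.

End Regularity.

(** * Toric description of the ideal of a complete graph *)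

Section GraphIdeals.
Variables (K : fieldType) (n : nat).
Local Notation S := {mpoly K[n + n]}.
Implicit Types (W : {set 'I_n}) (E : rel 'I_n) (p : S) (i j v : 'I_n).

Local Notation x i := ('X_(lshift n i) : S).
Local Notation y i := ('X_(rshift n i) : S).
Local Notation e i j := (edge_binomial K i j).

Definition vertex (k : 'I_(n + n)) : 'I_n :=
  match split k with inl i => i | inr i => i end.

Global Arguments vertex : simpl never.

Lemma vertex_l i : vertex (lshift n i) = i.
Proof. by rewrite /vertex -[lshift _ _]/(unsplit (inl i)) unsplitK. Qed.

Lemma vertex_r i : vertex (rshift n i) = i.
Proof. by rewrite /vertex -[rshift _ _]/(unsplit (inr i)) unsplitK. Qed.

Lemma var_split (P : 'I_(n + n) -> Prop) :
  (forall i, P (lshift n i)) -> (forall i, P (rshift n i)) -> forall k, P k.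
Proof. by move=> hl hr k; rewrite -[k]splitK; case: (split k). Qed.

Definition vars (Z : pred 'I_(n + n)) : seq S := [seq 'X_k | k <- enum Z].

(** The variables of vertices outside [W] are generators, so [W] can shrink in a fixed ring. *)
Definition graph_gens W E : seq S :=
  vars [pred k | vertex k \notin W] ++
  [seq e a.1 a.2 | a <- enum [pred a : 'I_n * 'I_n | [&& a.1 \in W, a.2 \in W & E a.1 a.2]]].

Definition graph_ideal W E : S -> Prop := idl (graph_gens W E).

Lemma vars_mem (Z : pred 'I_(n + n)) k : Z k -> 'X_k \in vars Z.
Proof. by move=> Zk; apply: map_f; rewrite mem_enum. Qed.

Lemma graph_ideal_var W E k : vertex k \notin W -> graph_ideal W E 'X_k.
Proof. by move=> kW; apply: idl_mem; rewrite mem_cat vars_mem. Qed.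

Lemma graph_ideal_edge W E i j : i \in W -> j \in W -> E i j -> graph_ideal W E (e i j).
Proof.
move=> iW jW ij; apply: idl_mem; rewrite mem_cat; apply/orP; right.
by apply/mapP; exists (i, j); rewrite // mem_enum inE /= iW jW.
Qed.

Lemma graph_ideal_min W E (I : S -> Prop) : ideal I ->
  (forall k, vertex k \notin W -> I 'X_k) ->
  (forall i j, i \in W -> j \in W -> E i j -> I (e i j)) ->
  forall p, graph_ideal W E p -> I p.
Proof.
move=> iI Ivar Iedge p; apply: idl_min => // g; rewrite mem_cat => /orP[].
  by move=> /mapP[k]; rewrite mem_enum => kW ->; apply: Ivar.
by move=> /mapP[[i j]]; rewrite mem_enum inE /= => /and3P[iW jW ij] ->; apply: Iedge.
Qed.

Lemma edge_ishom i j : ishom 2 (e i j).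
Proof. by apply: ishomB; apply: (@ishomM _ _ 1 1); apply: ishom_var. Qed.

Lemma edge_diag i : e i i = 0.
Proof. by rewrite /edge_binomial mulrC subrr. Qed.

Lemma edge_anti i j : e j i = - e i j.
Proof. by rewrite /edge_binomial; ring. Qed.

Lemma graph_ideal_homogeneous W E : homogeneous_ideal (graph_ideal W E).
Proof.
apply: idl_homogeneous => g; rewrite mem_cat => /orP[] /mapP[k _ ->].
  by exists 1; apply: ishom_var.
by exists 2; apply: edge_ishom.
Qed.

Section Toric.
Variable W : {set 'I_n}.
Local Notation T := {mpoly K[n.+1]}.

(* x_i |-> s u_i and y_i |-> u_i for i in W, the other variables going to 0 *)
Definition toric_var (k : 'I_(n + n)) : T :=
  match split k with
  | inl i => if i \in W then 'X_ord0 * 'X_(lift ord0 i) else 0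
  | inr i => if i \in W then 'X_(lift ord0 i) else 0
  end.

Definition toric : S -> T := mmap (@mpolyC n.+1 K) toric_var.

HB.instance Definition _ := GRing.RMorphism.copy toric (mmap (@mpolyC n.+1 K) toric_var).

Lemma toric_x i : toric (x i) = if i \in W then 'X_ord0 * 'X_(lift ord0 i) else 0.
Proof.
by rewrite /toric mmapX mmap1U /toric_var -[lshift _ _]/(unsplit (inl i)) unsplitK.
Qed.

Lemma toric_y i : toric (y i) = if i \in W then 'X_(lift ord0 i) else 0.
Proof.
by rewrite /toric mmapX mmap1U /toric_var -[rshift _ _]/(unsplit (inr i)) unsplitK.
Qed.

Local Notation J := (graph_ideal W (fun _ _ => true)).
Let iJ : ideal J. Proof. exact: idl_ideal. Qed.

Lemma toric_graph_ideal p : J p -> toric p = 0.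
Proof.
apply: (@graph_ideal_min W _ (fun p => toric p = 0)).
- split=> [|a b ha hb|a b hb]; first exact: rmorph0.
    by rewrite rmorphD /= ha hb addr0.
  by rewrite rmorphM /= hb mulr0.
- apply: var_split => i; rewrite (vertex_l, vertex_r) => /negbTE iW.
    by rewrite toric_x iW.
  by rewrite toric_y iW.
- move=> i j iW jW _; rewrite rmorphB !rmorphM /= !toric_x !toric_y iW jW; ring.
Qed.

(** The exponent at [ord0] is the power of s, that is the total degree in the x variables; the
    others are the degrees at the single vertices. *)
Definition toric_exp (m : 'X_{1..n + n}) : 'X_{1..n.+1} :=
  [multinom if unlift ord0 k is Some i then (m (lshift n i) + m (rshift n i))%N
            else (\sum_i m (lshift n i))%N | k < n.+1].

Lemma toric_exp0 m : toric_exp m ord0 = (\sum_i m (lshift n i))%N.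
Proof. by rewrite mnmE unlift_none. Qed.

Lemma toric_expS m i : toric_exp m (lift ord0 i) = (m (lshift n i) + m (rshift n i))%N.
Proof. by rewrite mnmE liftK. Qed.

Lemma toric_expP m m' :
  toric_exp m = toric_exp m' <->
  (\sum_i m (lshift n i) = \sum_i m' (lshift n i))%N /\
  forall i, (m (lshift n i) + m (rshift n i) = m' (lshift n i) + m' (rshift n i))%N.
Proof.
split=> [mm'|[h0 hS]].
  by rewrite -!toric_exp0 mm'; split=> // i; rewrite -!toric_expS mm'.
apply/mnmP => k; case: (unliftP ord0 k) => [i|] ->.
  by rewrite !toric_expS.
by rewrite !toric_exp0.
Qed.

Lemma toric_expD m m' : toric_exp (m + m')%MM = (toric_exp m + toric_exp m')%MM.
Proof.
apply/mnmP => k; rewrite mnmDE; case: (unliftP ord0 k) => [i|] ->.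
  by rewrite !toric_expS !mnmDE addnACA.
by rewrite !toric_exp0 -big_split; apply: eq_bigr => i _; rewrite mnmDE.
Qed.

Definition live (m : 'X_{1..n + n}) := [forall k, (m k != 0%N) ==> (vertex k \in W)].

Lemma liveP (m : 'X_{1..n + n}) : reflect (forall k, m k != 0%N -> vertex k \in W) (live m).
Proof. by apply: (iffP forallP) => h k; apply/implyP; apply: h. Qed.

Lemma not_live m : ~~ live m -> J 'X_[m].
Proof.
case/forallPn => k; rewrite negb_imply => /andP[mk kW].
have -> : m = (m - U_(k) + U_(k))%MM by rewrite submK // lep1mP.
by rewrite mpolyXD; case: iJ => _ _; apply; apply: graph_ideal_var.
Qed.

Lemma toricX m : live m -> toric 'X_[m] = 'X_[toric_exp m].
Proof.
move=> /liveP lm; rewrite /toric mmapX /mmap1 big_split_ord /= mpolyXE_id big_ord_recl.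
rewrite toric_exp0 expr_sum -!big_split /=; apply: eq_bigr => i _.
rewrite toric_expS exprD mulrA /toric_var.
rewrite -[lshift _ _]/(unsplit (inl i)) -[rshift _ _]/(unsplit (inr i)) !unsplitK /=.
have a0 a : i \notin W -> vertex a = i -> m a = 0%N.
  by move=> iW ai; apply/eqP; apply: contraNT iW => /lm; rewrite ai.
case: ifP => [_|/negbT iW]; first by rewrite exprMn.
by rewrite !a0 ?vertex_l ?vertex_r // !expr0 !mulr1.
Qed.

(* Two live monomials with the same image differ by an element of J: divide by
   a common variable, or, if there is none, exchange x_j y_i for x_i y_j. *)
Lemma toric_exp_congr m m' : live m -> live m' -> toric_exp m = toric_exp m' ->
  J ('X_[m] - 'X_[m']).
Proof.
have [d] := ubnP (mdeg m); elim: d m m' => // d IHd m m' md.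
have common k (m1 m2 : 'X_{1..n + n}) : (mdeg m1 < d.+1)%N -> live m1 -> live m2 ->
    toric_exp m1 = toric_exp m2 -> m1 k != 0%N -> m2 k != 0%N -> J ('X_[m1] - 'X_[m2]).
  rewrite -!lep1mP => md1 l1 l2 + k1 k2; rewrite -(submK k1) -(submK k2).
  rewrite !toric_expD => /addIm te; rewrite !mpolyXD -mulrBl; apply: (ideal_mulr _ iJ).
  apply: IHd te.
  - by move: md1; rewrite -{1}(submK k1) mdegD mdeg1 addn1 ltnS.
  - apply/liveP => i; rewrite mnmBE => ne; apply: (liveP _ l1).
    by apply: contraNneq ne => ->; rewrite sub0n.
  - apply/liveP => i; rewrite mnmBE => ne; apply: (liveP _ l2).
    by apply: contraNneq ne => ->; rewrite sub0n.
move=> lm lm' te; have [te0 teS] := (toric_expP m m').1 te.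
have [k /andP[mk m'k]|no] := pickP (fun k => (m k != 0) && (m' k != 0))%N.
  exact: (common k).
have [i mi|m0] := pickP (fun i => m (lshift n i) != 0%N); last first.
  suff -> : m = m' by rewrite subrr; case: iJ.
  have s0 : (\sum_i m (lshift n i) = 0)%N.
    by rewrite big1 // => i _; apply/eqP; have := m0 i; case: eqP.
  have m'0 i : m' (lshift n i) = 0%N.
    by apply/eqP; move: te0; rewrite s0 => /esym/eqP; rewrite sum_nat_eq0 => /forallP/(_ i).
  apply/mnmP; apply: var_split => i.
    by rewrite m'0; apply/eqP; have := m0 i; case: eqP.
  have := teS i; rewrite m'0 add0n => <-.
  by have := m0 i; case: eqP => // ->.
(* Nothing is shared, so x_i does not divide m'. Equal degrees at vertex i then force y_i into m',
   and equal x-degrees force some x_j. *)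
have m'i : m' (lshift n i) = 0%N.
  by apply/eqP; have := no (lshift n i); rewrite mi /=; case: eqP.
have m'yi : m' (rshift n i) != 0%N by have := teS i; rewrite m'i; lia.
have [j m'j|m'0] := pickP (fun j => m' (lshift n j) != 0%N); last first.
  move: te0; rewrite [RHS]big1; last by move=> j _; apply/eqP; have := m'0 j; case: eqP.
  by move/eqP; rewrite sum_nat_eq0 => /forallP/(_ i); rewrite (negbTE mi).
have ij : i != j by apply: contraNneq m'j => <-; rewrite m'i.
have iW : i \in W by rewrite -(vertex_l i); apply: (liveP _ lm).
have jW : j \in W by rewrite -(vertex_l j); apply: (liveP _ lm').
pose c := (m' - (U_(lshift n j) + U_(rshift n i)))%MM.
have m'E : m' = (c + (U_(lshift n j) + U_(rshift n i)))%MM.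
  rewrite /c submK //; apply/mnm_lepP; apply: var_split => k; rewrite mnmDE !mnm1E.
    rewrite (inj_eq (@lshift_inj _ _)) eq_rlshift addn0.
    by case: eqP => // <-; rewrite lt0n.
  by rewrite eq_lrshift (inj_eq (@rshift_inj _ _)) add0n; case: eqP => // <-; rewrite lt0n.
(* [m1] shares x_i with m and differs from m' by a monomial multiple of an edge binomial. *)
pose m1 := (c + (U_(lshift n i) + U_(rshift n j)))%MM.
have te1 : toric_exp m1 = toric_exp m'.
  rewrite m'E /m1 !toric_expD; congr (_ + _)%MM; apply/mnmP => k; rewrite !mnmDE.
  case: (unliftP ord0 k) => [l|] ->.
    rewrite !toric_expS !mnm1E !(inj_eq (@lshift_inj _ _)) !(inj_eq (@rshift_inj _ _)).
    by rewrite !eq_lrshift !eq_rlshift !addn0 !add0n addnC.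
  rewrite !toric_exp0 -!big_split /= (bigD1 i) //= (bigD1 j) 1?eq_sym //=.
  rewrite [RHS](bigD1 i) //= [X in _ = (_ + X)%N](bigD1 j) 1?eq_sym //= !addnA.
  congr (_ + _)%N.
    rewrite !mnm1E !(inj_eq (@lshift_inj _ _)) !eq_rlshift !eqxx.
    by rewrite (negbTE ij) eq_sym (negbTE ij).
  apply: eq_bigr => l /andP[li lj]; rewrite !mnm1E !(inj_eq (@lshift_inj _ _)) !eq_rlshift.
  by rewrite ![_ == l]eq_sym (negbTE li) (negbTE lj).
have lm1 : live m1.
  apply/liveP => k; rewrite /m1 !mnmDE !mnm1E.
  case: (eqVneq (lshift n i) k) => [<-|_]; first by rewrite vertex_l.
  case: (eqVneq (rshift n j) k) => [<-|_]; first by rewrite vertex_r.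
  rewrite !addn0 => ck; apply: (liveP _ lm'); rewrite m'E mnmDE.
  by apply: contraNneq ck => /eqP; rewrite addn_eq0 => /andP[].
have -> : 'X_[m] - 'X_[m'] = ('X_[m] - 'X_[m1]) + ('X_[m1] - 'X_[m']) :> S.
  by rewrite addrA subrK.
case: (iJ) => _ JD JM; apply: JD.
  apply: (common (lshift n i)) => //; first by rewrite te1.
  by rewrite /m1 !mnmDE !mnm1E eqxx eq_rlshift; lia.
rewrite m'E /m1 !mpolyXD -mulrBr; apply: JM.
have := @graph_ideal_edge W (fun _ _ => true) i j iW jW isT.
by rewrite /edge_binomial [y i * _]mulrC.
Qed.

(** Induction on the number of terms. The leading term is dropped if it is not live, or merged into
    another live term with the same image; otherwise its image cannot cancel. *)
Lemma toric_ker p : toric p = 0 -> J p.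
Proof.
case: (iJ) => J0 JD JM.
have JZ c q : J q -> J (c *: q) by rewrite -mul_mpolyC; apply: JM.
have toricZ c q : toric (c *: q) = c *: toric q by rewrite /toric mmapZ mul_mpolyC.
have [k] := ubnP (size (msupp p)); elim: k p => // k IHk p pk tp.
have [->//|p0] := eqVneq p 0.
have mp := mlead_supp p0; set m := mlead p in mp.
have rem_size (q : S) : {subset msupp q <= rem m (msupp p)} -> (size (msupp q) < k)%N.
  move=> sub; have := uniq_leq_size (msupp_uniq q) sub; rewrite size_rem // => h.
  by apply: leq_ltn_trans h _; case: (msupp p) mp pk => //= a l _; rewrite ltnS.
have [lm|lm] := boolP (live m); last first.
  rewrite -(subrK (p@_m *: 'X_[m]) p); have Jm := not_live lm.
  apply: (JD); last exact: JZ.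
  apply: IHk; last by rewrite rmorphB /= tp toricZ (toric_graph_ideal Jm) scaler0 subr0.
  by apply: rem_size => z; rewrite (perm_mem (msupp_rem _ _)).
have [[m' /and4P[m'p m'm lm' /eqP te]]|no] :
    (exists m', [&& m' \in msupp p, m' != m, live m' & toric_exp m' == toric_exp m]) \/
    (forall m', m' \in msupp p -> m' != m -> live m' -> toric_exp m' != toric_exp m).
- case: (boolP (has (fun m' => [&& m' != m, live m' & toric_exp m' == toric_exp m]) (msupp p))).
    by move=> /hasP[m' m'p h]; left; exists m'; rewrite m'p.
  move=> /hasPn h; right => m' m'p m'm lm'.
  by have := h m' m'p; rewrite m'm lm'.
- pose q := p@_m *: ('X_[m] - 'X_[m']) : S.
  have Jq : J q by apply/JZ/toric_exp_congr.
  rewrite -(subrK q p); apply: (JD) => //.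
  apply: IHk; last by rewrite rmorphB /= tp (toric_graph_ideal Jq) subr0.
  apply: rem_size => z; rewrite mem_rem_uniq ?msupp_uniq // !inE !mcoeff_msupp.
  rewrite mcoeffB mcoeffZ mcoeffB !mcoeffX.
  have [<-|_] := eqVneq m z; first by rewrite (negbTE m'm) subr0 mulr1 subrr eqxx.
  have [<- _|_] := eqVneq m' z; first by rewrite -mcoeff_msupp.
  by rewrite subrr mulr0 subr0.
- have := congr1 (mcoeff (toric_exp m)) tp; rewrite {1}[p]mpolyE rmorph_sum raddf_sum /=.
  rewrite (bigD1_seq m) //= big_seq_cond big1 => [|m' /andP[m'p m'm]].
    rewrite toricZ toricX // mcoeffZ mcoeffX eqxx mulr1 addr0 mcoeff0 => /eqP.
    by rewrite mcoeff_eq0 mp.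
  rewrite toricZ mcoeffZ; have [lm'|/not_live/toric_graph_ideal ->] := boolP (live m').
    by rewrite toricX // mcoeffX (negbTE (no m' m'p m'm lm')) mulr0.
  by rewrite mcoeff0 mulr0.
Qed.

(** The ideal is the kernel of [toric], whose target is a domain, and x_v has nonzero image. *)
Lemma complete_x_regular v p : v \in W -> J (p * x v) -> J p.
Proof.
move=> vW /toric_graph_ideal/eqP; rewrite rmorphM /= toric_x vW !mulf_eq0.
by rewrite -!msupp_eq0 !msuppX /= orbF => h; apply/toric_ker/eqP; rewrite -msupp_eq0.
Qed.

End Toric.

End GraphIdeals.

(** * Cones and linear forests *)

Section GraphRegularity.
Variables (K : fieldType) (n : nat).
Local Notation S := {mpoly K[n + n]}.
Implicit Types (W : {set 'I_n}) (E : rel 'I_n) (p : S) (i j v : 'I_n).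

Local Notation x i := ('X_(lshift n i) : S).
Local Notation y i := ('X_(rshift n i) : S).
Local Notation e i j := (edge_binomial K i j).
Local Notation J := (@graph_ideal K n).
Local Notation complete := (fun _ _ => true).

Lemma var_neq0 k : 'X_k != 0 :> S.
Proof. by rewrite -msupp_eq0 msuppX. Qed.

Lemma mcoprime_var (m : 'X_{1..n + n}) k : m k = 0%N -> mcoprime m U_(k)%MM.
Proof.
move=> mk; apply/forallP => l; rewrite mnm1E.
by case: (eqVneq k l) => [<-|_]; rewrite ?mk ?orbT.
Qed.

Lemma mcoprimeD (m m1 m2 : 'X_{1..n + n}) :
  mcoprime m m1 -> mcoprime m m2 -> mcoprime m (m1 + m2)%MM.
Proof.
move=> /forallP h1 /forallP h2; apply/forallP => k; rewrite mnmDE addn_eq0.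
by have := h1 k; have := h2 k; case: (m k == 0%N) => //= -> ->.
Qed.

Lemma vars_good (Z : pred 'I_(n + n)) f : f \in vars K Z ->
  [/\ f != 0, ishom (mdeg (mlead f))%:Z f & (0 < mdeg (mlead f))%N].
Proof.
move=> /mapP[k _ ->]; rewrite mleadXm mdeg1 var_neq0; split=> //.
exact: ishom_var.
Qed.

Lemma vars_coprime (Z : pred 'I_(n + n)) :
  pairwise (fun f g : S => mcoprime (mlead g) (mlead f)) (vars K Z).
Proof.
rewrite pairwise_map; have := enum_uniq Z; rewrite uniq_pairwise.
apply: sub_pairwise => k l /= kl; rewrite !mleadXm; apply: mcoprime_var.
by rewrite mnm1E eq_sym (negbTE kl).
Qed.

Lemma vars_degree (Z : pred 'I_(n + n)) : (\sum_(f <- vars K Z) (mdeg (mlead f)).-1 = 0)%N.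
Proof. by rewrite big_map big1 // => k _; rewrite mleadXm mdeg1. Qed.

Lemma vars_reg (Z : pred 'I_(n + n)) : reg_le (idl (vars K Z)) 0.
Proof.
have [_ + _] := coprime_lead_tor (@vars_good Z) (vars_coprime Z).
by rewrite vars_degree.
Qed.

Lemma vars_regular (Z : pred 'I_(n + n)) k p : ~~ Z k ->
  idl (vars K Z) (p * 'X_k) -> idl (vars K Z) p.
Proof.
move=> Zk; have [gb _ _] := coprime_lead_tor (@vars_good Z) (vars_coprime Z).
apply: (coprime_lead_regular gb _ (var_neq0 k)); first by move=> g /vars_good[].
move=> g /mapP[l]; rewrite mem_enum => Zl ->; rewrite !mleadXm; apply: mcoprime_var.
by rewrite mnm1E; case: eqP => // lk; case/negP: Zk; rewrite -lk.
Qed.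

Lemma graph_ideal_sub W E E' p : (forall i j, i \in W -> j \in W -> E i j -> E' i j) ->
  J W E p -> J W E' p.
Proof.
move=> sub; apply: graph_ideal_min; first exact: idl_ideal.
  by move=> k; apply: graph_ideal_var.
by move=> i j iW jW /(sub i j iW jW); apply: graph_ideal_edge.
Qed.

(** * Colon and sum ideals of a cone with apex [v] *)

Section Cone.
Variables (W : {set 'I_n}) (E : rel 'I_n) (v : 'I_n).
Hypotheses (vW : v \in W) (coneE : forall i, i \in W -> i != v -> E v i).

Let iJ : ideal (J W E). Proof. exact: idl_ideal. Qed.

Let cone_edge i : i \in W -> J W E (e v i).
Proof.
move=> iW; case: (eqVneq i v) => [->|iv]; first by rewrite edge_diag; case: iJ.
by apply: graph_ideal_edge => //; apply: coneE.
Qed.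

(** The identity x_v e_ij = x_i e_vj - x_j e_vi gives one inclusion; the other holds because x_v is
    regular modulo the larger complete ideal. *)
Lemma cone_colon_x p : J W complete p <-> J W E (p * x v).
Proof.
case: (iJ) => J0 JD JM; split=> [|h]; last first.
  by apply: complete_x_regular vW _; apply: graph_ideal_sub h.
apply: (@graph_ideal_min _ _ W complete (fun p => J W E (p * x v))).
- split=> [|a b ha hb|a b hb]; first by rewrite mul0r.
    by rewrite mulrDl; apply: JD.
  by rewrite -mulrA; apply: JM.
- by move=> k kW; rewrite mulrC; apply/JM/graph_ideal_var.
- move=> i j iW jW _.
  have -> : e i j * x v = x i * e v j - x j * e v i by rewrite /edge_binomial; ring.
  by apply: ideal_sub => //; apply/JM/cone_edge.
Qed.

(** All x variables, together with both variables of each vertex outside [W]. *)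
Let Z : pred 'I_(n + n) := [pred k | (k == lshift n (vertex k)) || (vertex k \notin W)].
Let J1 := ideal_add (J W E) (x v).

Let hJ1 : homogeneous_ideal J1.
Proof. by apply: homogeneous_add (@ishom_var K _ (lshift n v)); apply: graph_ideal_homogeneous. Qed.

Let iJ1 : ideal J1. Proof. by case: hJ1. Qed.

Let sub1 p : J W E p -> J1 p.
Proof. by exists 0; rewrite mul0r subr0. Qed.

Let J1x : J1 (x v).
Proof. by exists 1; rewrite mul1r subrr; case: iJ. Qed.

(** Modulo x_v, the binomial e_vi becomes -x_i y_v. Conversely [J1] lies in the ideal generated by
    the variables of [Z], modulo which y_v is regular. *)
Lemma cone_colon_y p : idl (vars K Z) p <-> J1 (p * y v).
Proof.
case: (iJ1) => J0 JD JM; have iP := idl_ideal (vars K Z); split.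
  apply: (@idl_min _ _ _ (fun p => J1 (p * y v))).
    split=> [|a b ha hb|a b hb]; first by rewrite mul0r.
      by rewrite mulrDl; apply: JD.
    by rewrite -mulrA; apply: JM.
  move=> g /mapP[k]; rewrite mem_enum inE => kZ ->.
  case: (boolP (vertex k \in W)) => kW; last first.
    by rewrite mulrC; apply/JM/sub1/graph_ideal_var.
  move: kZ; rewrite kW orbF => /eqP ->; move: (vertex k) kW => i iW.
  have -> : x i * y v = y i * x v - e v i by rewrite /edge_binomial; ring.
  by apply: ideal_sub => //; [exact: (JM _ _ J1x) | apply/sub1/cone_edge].
have vZ : ~~ Z (rshift n v) by rewrite /Z /= vertex_r vW eq_rlshift.
have xZ i : idl (vars K Z) (x i).
  by apply/idl_mem/vars_mem; rewrite /Z /= vertex_l eqxx.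
case=> h hp; apply: (vars_regular vZ).
rewrite -(subrK (h * x v) (p * y v)); case: (iP) => _ PD PM; apply: (PD); last exact: PM.
move: hp; apply: graph_ideal_min => // [k kW|i j _ _ _].
  by apply/idl_mem/vars_mem; rewrite /Z /= kW orbT.
by rewrite /edge_binomial; apply: ideal_sub => //; [rewrite mulrC|]; apply: PM.
Qed.

Lemma cone_add_y p : J (W :\ v) E p <-> exists h, J1 (p - h * y v).
Proof.
have iJv := @idl_ideal K _ (graph_gens K (W :\ v) E).
have Jvar k : vertex k = v -> J (W :\ v) E 'X_k.
  by move=> kv; apply: graph_ideal_var; rewrite kv !inE eqxx.
have [Jx Jy] : J (W :\ v) E (x v) /\ J (W :\ v) E (y v).
  by split; apply: Jvar; rewrite (vertex_l, vertex_r).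
case: (iJv) => _ JvD JvM; split; last first.
  case=> h [h' hp].
  have -> : p = (p - h * y v - h' * x v) + (h * y v + h' * x v) by ring.
  apply: (JvD); last by apply: (JvD); apply: JvM.
  move: hp; apply: graph_ideal_min => // [k kW|i j iW jW ij].
    by apply: graph_ideal_var; rewrite !inE negb_and kW orbT.
  case: (eqVneq i v) => [->|iv].
    by apply: ideal_sub => //; [rewrite mulrC|rewrite mulrC]; apply: JvM.
  case: (eqVneq j v) => [->|jv].
    by apply: ideal_sub => //; apply: JvM.
  by apply: graph_ideal_edge; rewrite ?inE ?iv ?jv.
have [iA _] := homogeneous_add hJ1 (@ishom_var K _ (rshift n v)).
apply: (graph_ideal_min iA) => [k|i j].
  rewrite !inE negb_and negbK => /orP[/eqP kv|kW]; last first.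
    by exists 0; rewrite mul0r subr0; apply/sub1/graph_ideal_var.
  move: kv; apply: (@var_split n (fun k => vertex k = v -> exists h, J1 ('X_k - h * y v))) => i.
    by rewrite vertex_l => ->; exists 0; rewrite mul0r subr0.
  by rewrite vertex_r => ->; exists 1; rewrite mul1r subrr; case: iJ1.
rewrite !inE => /andP[_ iW] /andP[_ jW] ij; exists 0; rewrite mul0r subr0.
by apply/sub1/graph_ideal_edge.
Qed.

Let les_x (i : nat) (j : int) := tor_les (@graph_ideal_homogeneous K n W E)
  (@ishom_var K _ (lshift n v))
  cone_colon_x (fun p => iff_refl (J1 p)) i j.

Let les_y (i : nat) (j : int) := tor_les hJ1
  (@ishom_var K _ (rshift n v)) cone_colon_y cone_add_y i j.

Let tor_J1 (i : nat) (j : int) : tor J1 i j -> j - i%:Z <= 1 \/ tor (J (W :\ v) E) i j.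
Proof.
have [_ h _] := les_y i j; move/h => [/vars_reg|]; last by right.
by move=> ?; left; lia.
Qed.

(** The quotient by the variables of [Z] has regularity 0, so after the shift by y_v it reaches only
    j - i at most 1. *)
Lemma tor_cone_upper (i : nat) (j : int) : tor (J W E) i j ->
  [\/ j - i%:Z <= 1, tor (J W complete) i (j - 1) | tor (J (W :\ v) E) i j].
Proof.
have [_ h _] := les_x i j; move/h => [?|/tor_J1[?|?]]; [exact: Or32 | exact: Or31 | exact: Or33].
Qed.

(** Above the diagonal j - i = 0, the second sequence cannot absorb a class of the base, so it lifts
    to [J1]; the first sequence then gives the two alternatives. *)
Lemma tor_cone_lower (i : nat) (j : int) : tor (J (W :\ v) E) i j -> 1 <= j - i%:Z ->
  tor (J W E) i j \/ exists2 i', i = i'.+1 & tor (J W complete) i' (j - 1).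
Proof.
move=> t ij; have [hx _ _] := les_x i j; apply: hx; have [hy _ _] := les_y i j.
case: (hy t) => // -[i' ii' /vars_reg]; lia.
Qed.

Lemma tor_cone_shift (i : nat) (j : int) : tor (J W complete) i (j - 1) ->
  [\/ tor (J W E) i j, j - i%:Z <= 2 | tor (J (W :\ v) E) i.+1 j].
Proof.
have [_ _ h] := les_x i j; move/h => [?|/tor_J1[?|?]];
  [exact: Or31 | apply: Or32; lia | exact: Or33].
Qed.

End Cone.

(** For complete [W] both ends of the first sequence are the same ideal, so a class with j - i > 1
    forces one in degree j + 1 at the same position, and so on forever. This contradicts
    [tor_bounded]. *)
Lemma complete_reg W : reg_le (J W complete) 1.
Proof.
have [d] := ubnP #|W|; elim: d W => // d IHd W Wd i j t.
have [W0|[v vW]] := set_0Vmem W.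
  have sub : forall p, J W complete p <-> idl (vars K predT) p.
    move=> p; split; last first.
      apply: idl_min; first exact: idl_ideal.
      by move=> g /mapP[k _ ->]; apply: graph_ideal_var; rewrite W0 inE.
    apply: graph_ideal_min; first exact: idl_ideal.
      by move=> k _; apply/idl_mem/vars_mem.
    by move=> a b; rewrite W0 inE.
  by have := vars_reg (tor_ext sub t); lia.
have IH : reg_le (J (W :\ v) complete) 1.
  by apply: IHd; move: Wd; rewrite (cardsD1 v W) vW; lia.
rewrite leNgt; apply/negP => ij.
have up k : tor (J W complete) i (j + k%:Z).
  elim: k => [|k]; first by rewrite addr0.
  have -> : j + k%:Z = j + k.+1%:Z - 1 by lia.
  move/(@tor_cone_shift W complete v vW (fun _ _ _ => isT)) => [//|?|/IH]; lia.
have [b hb] := @tor_bounded _ _ _ i (@graph_ideal_homogeneous K n W complete).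
have := hb _ (up (absz (b - j + 1))); lia.
Qed.

(** * Linear forests *)

Section Edges.
Variables (W : {set 'I_n}) (E : rel 'I_n) (l : seq ('I_n * 'I_n)).
(** Edges go from smaller to larger labels, and no two share a first or a second endpoint: a
    disjoint union of paths with increasing labels. *)
Hypotheses (l_uniq : uniq l)
  (lW : forall a, a \in l -> [/\ a.1 \in W, a.2 \in W & (a.1 < a.2)%N])
  (l_fst : forall a b, a \in l -> b \in l -> a.1 = b.1 -> a = b)
  (l_snd : forall a b, a \in l -> b \in l -> a.2 = b.2 -> a = b)
  (El : forall i j, i \in W -> j \in W -> E i j = ((i, j) \in l) || ((j, i) \in l)).

(** Both monomials have degree 2, and the tie is broken at the smallest variable where they differ,
    which is x_i. *)
Lemma edge_lead i j : (i < j)%N ->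
  mlead (e i j) = (U_(lshift n i) + U_(rshift n j))%MM /\ mleadc (e i j) = 1.
Proof.
move=> ij; rewrite /edge_binomial -!mpolyXD.
have lt : ((U_(rshift n i) + U_(lshift n j))%MM < (U_(lshift n i) + U_(rshift n j))%MM)%O.
  apply/ltmcP; first by rewrite !mdegD !mdeg1.
  exists (lshift n i) => [k ki|]; rewrite !mnmDE !mnm1E.
    have kj : (k < n)%N by apply: ltn_trans (ltn_ord i).
    rewrite -!val_eqE /=; rewrite /= in ki; lia.
  by have := ltn_ord i; rewrite -!val_eqE /=; lia.
have lead : mlead ('X_[U_(lshift n i) + U_(rshift n j)] - 'X_[U_(rshift n i) + U_(lshift n j)] : S)
    = (U_(lshift n i) + U_(rshift n j))%MM.
  by rewrite mleadDl ?mleadN ?mleadXm.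
split=> //; rewrite lead mcoeffB !mcoeffX eqxx.
by rewrite (lt_eqF lt) subr0.
Qed.

Let es : seq S := [seq e a.1 a.2 | a <- l].
Let dead : seq S := vars K [pred k | vertex k \notin W].

(** The dead variables and one binomial per edge form a complete intersection; a variable adds 0 to
    the regularity and a quadric adds 1. *)
Lemma edges_tor : reg_le (J W E) (size l) /\
  tor (J W E) (size dead + size l)%N (size dead + size l + size l)%N.
Proof.
have JE p : J W E p <-> idl (dead ++ es) p.
  have iI := idl_ideal (dead ++ es); split.
    apply: graph_ideal_min => // [k kW|i j iW jW].
      by apply: idl_mem; rewrite mem_cat vars_mem.
    rewrite El // => /orP[ij|ji].
      apply: idl_mem; rewrite mem_cat; apply/orP; right.
      by apply/mapP; exists (i, j).
    rewrite edge_anti; apply: ideal_opp => //.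
    apply: idl_mem; rewrite mem_cat; apply/orP; right.
    by apply/mapP; exists (j, i).
  apply: idl_min; first exact: idl_ideal.
  move=> g; rewrite mem_cat => /orP[/mapP[k]|/mapP[[i j] al ->]].
    by rewrite mem_enum => kW ->; apply: graph_ideal_var.
  have [iW jW _] := lW al; apply: graph_ideal_edge => //.
  by rewrite El // al.
have good f : f \in dead ++ es ->
    [/\ f != 0, ishom (mdeg (mlead f))%:Z f & (0 < mdeg (mlead f))%N].
  rewrite mem_cat => /orP[/vars_good //|/mapP[a al ->]].
  have [_ _ /edge_lead[le lc]] := lW al.
  rewrite -mleadc_eq0 lc oner_eq0 le mdegD !mdeg1; split=> //; exact: edge_ishom.
have cop : pairwise (fun f g : S => mcoprime (mlead g) (mlead f)) (dead ++ es).
  rewrite pairwise_cat vars_coprime /=; apply/andP; split.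
    apply/allrelP => f g /mapP[k]; rewrite mem_enum inE => kW -> /mapP[a al ->].
    have [iW jW /edge_lead[le _]] := lW al.
    rewrite mleadXm le; apply: mcoprime_var; rewrite mnmDE !mnm1E.
    case: eqP => [ak|_]; first by rewrite -ak vertex_l iW in kW.
    by case: eqP => [ak|_]; first by rewrite -ak vertex_r jW in kW.
  rewrite pairwise_map; move: l_uniq; rewrite uniq_pairwise => lu.
  apply: (@sub_in_pairwise _ (mem l)) lu; last by apply/allP.
  move=> a b al bl /= ab.
  have [_ _ /edge_lead[-> _]] := lW al; have [_ _ /edge_lead[-> _]] := lW bl.
  apply: mcoprimeD; apply: mcoprime_var; rewrite mnmDE !mnm1E.
    rewrite eq_rlshift addn0 (inj_eq (@lshift_inj _ _)).
    by case: eqP => // ba; rewrite (l_fst bl al ba) eqxx in ab.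
  rewrite eq_lrshift add0n (inj_eq (@rshift_inj _ _)).
  by case: eqP => // ba; rewrite (l_snd bl al ba) eqxx in ab.
have := coprime_lead_tor good cop.
rewrite big_cat vars_degree /= big_map big_seq (eq_bigr (fun=> 1%N)) => [|a al]; last first.
  by have [_ _ /edge_lead[-> _]] := lW al; rewrite mdegD !mdeg1.
rewrite -big_seq sum1_size size_cat (size_map _ l) add0n => -[_ r t]; split.
  by move=> i j /(tor_ext JE); apply: r.
by apply: (tor_ext _ t) => p; apply: iff_sym.
Qed.

End Edges.

End GraphRegularity.

(** * The graphs *)

Lemma regularityP (K : fieldType) N (J : {mpoly K[N]} -> Prop) (rho : int) :
  homogeneous_ideal J -> (exists i j, tor J i j /\ j - i%:Z = rho) -> reg_le J rho ->
  is_regularity J rho.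
Proof.
move=> hJ [i [j [t ij]]] reg; have rJ := resolution_exists hJ.
split=> [|a b /(betti_tor _ _ hJ rJ)]; last exact: reg.
by exists i, j; split=> //; apply/(betti_tor _ _ hJ rJ).
Qed.

Lemma binomial_edge_idealE (K : fieldType) n (G : sgraph n) f :
  graph_ideal setT G f <-> binomial_edge_ideal (K:=K) G f.
Proof.
split; last first.
  have iJ := idl_ideal (graph_gens K setT G).
  case=> c ->; apply: ideal_sum => // i _; apply: ideal_sum => // j ij.
  by case: (iJ) => _ _; apply; apply: graph_ideal_edge; rewrite ?inE.
apply: graph_ideal_min => [|k|i j _ _ ij].
- split=> [|p q [c ->] [d ->]|p q [c ->]].
  + exists (fun _ _ => 0); rewrite big1 // => i _; rewrite big1 // => j _; exact: mul0r.
  + exists (fun i j => c i j + d i j); rewrite -big_split; apply: eq_bigr => i _ /=.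
    by rewrite -big_split; apply: eq_bigr => j _; rewrite mulrDl.
  + exists (fun i j => p * c i j); rewrite mulr_sumr; apply: eq_bigr => i _.
    by rewrite mulr_sumr; apply: eq_bigr => j _; rewrite mulrA.
- by rewrite inE.
- exists (fun a b => ((a == i) && (b == j))%:R).
  rewrite (bigD1 i) //= (bigD1 j) //= !eqxx mul1r big1 => [|b /andP[_ /negbTE->]].
    rewrite addr0 big1 ?addr0 // => a /negbTE ai; rewrite big1 // => b _.
    by rewrite ai mul0r.
  by rewrite andbF mul0r.
Qed.

Lemma graph_regularity (K : fieldType) n (G : sgraph n) (rho : int) :
  (exists i j, tor (@graph_ideal K n setT G) i j /\ j - i%:Z = rho) ->
  reg_le (@graph_ideal K n setT G) rho ->
  is_regularity (binomial_edge_ideal (K:=K) G) rho.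
Proof.
have eJ := @binomial_edge_idealE K n G; move=> [i [j [t ij]]] reg.
apply: regularityP.
- by apply: homogeneous_ideal_ext eJ _; apply: graph_ideal_homogeneous.
- by exists i, j; split=> //; apply: (tor_ext eJ t).
- by move=> a b /(tor_ext (fun g => iff_sym (eJ g))); apply: reg.
Qed.

(** * Complete graphs *)

Section Complete.
Variables (K : fieldType) (n : nat).
Implicit Types (W : {set 'I_n}).
Local Notation J := (@graph_ideal K n).

Lemma complete_neq W p : J W (fun _ _ => true) p <-> J W (fun i j => i != j) p.
Proof.
have iJ := idl_ideal (graph_gens K W (fun i j => i != j)).
split; last exact: graph_ideal_sub.
apply: graph_ideal_min => // [k|i j iW jW _]; first exact: graph_ideal_var.
case: (eqVneq i j) => [->|ij]; first by rewrite edge_diag; case: iJ.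
exact: graph_ideal_edge.
Qed.

(** Starting from a single edge, vertices are added as apexes. Either alternative of
    [tor_cone_lower] keeps j - i = 1, the second by lowering both indices. *)
Lemma complete_tor W : (1 < #|W|)%N ->
  exists i j, tor (J W (fun _ _ => true)) i j /\ j - i%:Z = 1.
Proof.
have [d] := ubnP #|W|; elim: d W => // d IHd W Wd W1.
have [W2|W2] := leqP #|W| 2.
  have [a [b [ab WE]]] : exists a b : 'I_n, (a < b)%N /\ W = [set a; b].
    have /cards2P[a [b [ab ->]]] : #|W| == 2%N by rewrite eqn_leq W2 W1.
    case: (ltngtP a b) => [lt|lt|/val_inj eab]; last by rewrite eab eqxx in ab.
      by exists a, b.
    by exists b, a; split=> //; rewrite setUC.
  have [|c|c c'|c c'|i j iW jW|_ t] :=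
    @edges_tor K n W (fun i j => i != j) [:: (a, b)]; rewrite ?inE //.
  - by move=> /eqP ->; rewrite WE !inE !eqxx orbT.
  - by move=> /eqP -> /eqP ->.
  - by move=> /eqP -> /eqP ->.
  - move: iW jW; rewrite WE !inE !xpair_eqE => /orP[] /eqP-> /orP[] /eqP->;
    rewrite !eqxx ?andbT ?orbT -!val_eqE /=; lia.
  do 2!eexists; split; first by apply: (tor_ext _ t) => p; exact: iff_sym (complete_neq W p).
  by move: (size _) => s; rewrite -[size _]/1%N; lia.
have [v vW] : exists v, v \in W by apply/set0Pn; rewrite -card_gt0; lia.
have cv := cardsD1 v W; rewrite vW in cv.
have [||i [j [t ij]]] := IHd (W :\ v); try by lia.
have [|?|[i' ii' t']] := tor_cone_lower vW (fun _ _ _ => isT) t; first by rewrite ij.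
  by exists i, j.
by exists i', (j - 1); split=> //; lia.
Qed.

Lemma complete_graph_regularity : (1 < n)%N ->
  exists G : sgraph n, [/\ connected_graph G, cograph G
    & is_regularity (binomial_edge_ideal (K:=K) G) 1].
Proof.
move=> n1; have sym : ssrbool.symmetric (fun i j : 'I_n => i != j) by move=> i j; rewrite eq_sym.
have irr : ssrbool.irreflexive (fun i j : 'I_n => i != j) by move=> i; rewrite eqxx.
exists (SGraph sym irr); split.
- split=> [|u v]; first exact: ltnW.
  by case: (eqVneq u v) => [->|uv]; [exact: connect0 | exact: connect1].
(* Vertices 0 and 2 of the path are distinct but not adjacent. *)
- case=> f [finj fP]; have := fP ord0 (inord 2).
  by rewrite /= (inj_eq finj) /P4 -val_eqE /= inordK.
- apply: graph_regularity => /=.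
    have [|i [j [t ij]]] := @complete_tor setT; first by rewrite cardsT card_ord.
    by exists i, j; split=> //; apply: (tor_ext (@complete_neq setT) t).
  by move=> i j /(tor_ext (fun p => iff_sym (complete_neq setT p))); apply: complete_reg.
Qed.

End Complete.

(** * Cones over disjoint paths *)

Section ConeOverPaths.
Variables (K : fieldType) (n r : nat) (v : 'I_n).

(* Edge k runs from path_start k to its successor, so that edges 2q and 2q+1
   form the path on the vertices 3q, 3q+1, 3q+2. *)
Definition path_start k := (k %/ 2 * 3 + k %% 2)%N.

(** The default [v] stands for labels out of range, which [start_lt] rules out. *)
Definition path_edges : seq ('I_n * 'I_n) :=
  [seq (insubd v (path_start k), insubd v (path_start k).+1) | k <- iota 0 r].

Definition cone_rel : rel 'I_n := fun i j =>
  (i != j) && [|| i == v, j == v, (i, j) \in path_edges | (j, i) \in path_edges].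

Lemma cone_rel_sym : ssrbool.symmetric cone_rel.
Proof. by move=> i j; rewrite /cone_rel eq_sym orbCA [((i, j) \in _) || _]orbC. Qed.

Lemma cone_rel_irr : ssrbool.irreflexive cone_rel.
Proof. by move=> i; rewrite /cone_rel eqxx. Qed.

Definition cone_graph := SGraph cone_rel_sym cone_rel_irr.

(** The paths stay below the apex; labels other than [v] hit by no edge are isolated vertices of the
    base. *)
Hypothesis start_lt : forall k, (k < r)%N -> ((path_start k).+1 < v)%N.

Lemma path_edgesP (i j : 'I_n) : reflect
  (exists2 k, (k < r)%N & i = path_start k :> nat /\ j = (path_start k).+1 :> nat)
  ((i, j) \in path_edges).
Proof.
have lt k : (k < r)%N -> ((path_start k).+1 < n)%N.
  by move=> /start_lt h; apply: ltn_trans h (ltn_ord v).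
apply: (iffP mapP) => [[k]|[k kr [ik jk]]].
  rewrite mem_iota => /andP[_ kr] [-> ->]; exists k => //.
  by rewrite !val_insubd (lt k kr) (ltnW (lt k kr)).
exists k; first by rewrite mem_iota.
by congr pair; apply: val_inj; rewrite val_insubd ?(lt k kr) ?(ltnW (lt k kr)).
Qed.

Lemma cone_graph_connected : connected_graph cone_graph.
Proof.
split=> [|a b]; first by apply: leq_ltn_trans (ltn_ord v).
have conn c : connect cone_graph c v /\ connect cone_graph v c.
  case: (eqVneq c v) => [->|cv]; first by split; apply: connect0.
  by split; apply: connect1; rewrite /= /cone_rel ?(eq_sym v) cv eqxx ?orbT.
by apply: connect_trans (conn a).1 (conn b).2.
Qed.

(** Every vertex of the 4-path misses another one, so an induced copy avoids the apex. Its edges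
    then preserve the quotient of labels by 3, and four distinct labels would share a block of
    three. *)
Lemma cone_graph_cograph : cograph cone_graph.
Proof.
case=> f [finj fP].
have nbr (a : 'I_4) : exists2 b, b != a & ~~ P4 a b.
  case: a => [[|[|[|[|//]]]] ha].
  - by exists (inord 2); rewrite -?val_eqE /P4 /= inordK.
  - by exists (inord 3); rewrite -?val_eqE /P4 /= inordK.
  - by exists (inord 0); rewrite -?val_eqE /P4 /= inordK.
  - by exists (inord 1); rewrite -?val_eqE /P4 /= inordK.
have fv a : f a != v.
  have [b ba] := nbr a; apply: contraNneq => fa.
  by rewrite -fP /= /cone_rel (inj_eq finj) eq_sym ba fa eqxx.
have step a b : P4 a b ->
    (f a %/ 3 = f b %/ 3)%N /\ (f a != f b).
  rewrite -fP /= /cone_rel (negbTE (fv a)) (negbTE (fv b)) /= => /andP[ne].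
  split=> //; case/orP: b0 => /path_edgesP[k _ [-> ->]]; rewrite /path_start; lia.
have p01 := @step (inord 0) (inord 1); have p12 := @step (inord 1) (inord 2).
have p23 := @step (inord 2) (inord 3).
have ne (a b : nat) : (a < 4)%N -> (b < 4)%N -> a <> b -> f (inord a) <> f (inord b) :> nat.
  move=> a4 b4 ab /val_inj/finj/(congr1 val); rewrite /= !inordK //.
have [//|+ _] := p01; first by rewrite /P4 !inordK.
have [//|+ _] := p12; first by rewrite /P4 !inordK.
have [//|+ _] := p23; first by rewrite /P4 !inordK.
have := @ne 0%N 1%N isT isT; have := @ne 0%N 2%N isT isT; have := @ne 0%N 3%N isT isT.
have := @ne 1%N 2%N isT isT; have := @ne 1%N 3%N isT isT; have := @ne 2%N 3%N isT isT.
lia.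
Qed.

(** The cone has regularity at most the maximum of 2 and [r]. The extremal class of the base
    survives because its other possible source would need j - i = [r] in a complete graph, where the
    bound is 1. *)
Lemma cone_graph_reg : (1 < r)%N ->
  is_regularity (binomial_edge_ideal (K:=K) cone_graph) r.
Proof.
move=> r1; pose W : {set 'I_n} := setT :\ v.
have coneE i : i \in setT -> i != v -> cone_rel v i.
  by move=> _ iv; rewrite /cone_rel eq_sym iv eqxx.
have [||a b|a b|i j|reg t] := @edges_tor K n W cone_rel path_edges.
- rewrite map_inj_in_uniq ?iota_uniq // => k k'; rewrite !mem_iota => kr kr' /(congr1 fst)/=.
  move/(congr1 val); rewrite !val_insubd.
  rewrite !ifT; last 2 first.
  + by have := start_lt kr'; have := ltn_ord v; lia.
  + by have := start_lt kr; have := ltn_ord v; lia.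
  by rewrite /path_start; lia.
- move=> [i j] /path_edgesP[k kr /= [ik jk]]; rewrite !inE -!val_eqE /=.
  by have := start_lt kr; split; lia.
- case: a b => [i j] [i' j'] /path_edgesP[k _ [ik jk]].
  move=> /path_edgesP[k' _ [ik' jk']] /(congr1 val)/= e.
  by congr pair; apply: val_inj => /=; lia.
- case: a b => [i j] [i' j'] /path_edgesP[k _ [ik jk]].
  move=> /path_edgesP[k' _ [ik' jk']] /(congr1 val)/= e.
  by congr pair; apply: val_inj => /=; lia.
- rewrite !inE !andbT => /negbTE iv /negbTE jv; rewrite /cone_rel iv jv /=.
  case: (eqVneq i j) => [<-|//]; rewrite orbb; apply/esym/negbTE/path_edgesP.
  by case=> k _ [ik]; rewrite ik; lia.
have sl : size path_edges = r by rewrite size_map size_iota.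
rewrite !sl in reg t.
apply: graph_regularity => /=; last first.
  move=> i j /(@tor_cone_upper K n setT cone_rel v (in_setT v) coneE).
  by case=> [?|/complete_reg ?|/reg //]; lia.
have [|?|[i' ii' /complete_reg]] := @tor_cone_lower K n setT cone_rel v (in_setT v) coneE _ _ t.
- lia.
- do 2!eexists; split; first by eassumption.
  lia.
- lia.
Qed.

End ConeOverPaths.

Lemma cone_graph_exists (K : fieldType) (n r : nat) : (1 < r)%N ->
  (forall k, (k < r)%N -> ((path_start k).+2 < n)%N) ->
  exists G : sgraph n, [/\ connected_graph G, cograph G
    & is_regularity (binomial_edge_ideal (K:=K) G) r].
Proof.
move=> r1 lt; have n0 : (n.-1 < n)%N by have := lt 0%N (ltnW r1); lia.
have start_lt k : (k < r)%N -> ((path_start k).+1 < Ordinal n0)%N.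
  by move=> /lt /=; lia.
exists (cone_graph r (Ordinal n0)); split.
- exact: cone_graph_connected.
- exact: cone_graph_cograph.
- exact: cone_graph_reg.
Qed.

Theorem proposition2p2 (K : fieldType) (r : nat) (hr : (1 <= r)%N) :
  (exists (n : nat) (G : sgraph n),
     [/\ connected_graph G, cograph G
       & is_regularity (binomial_edge_ideal (K:=K) G) (Posz r)])
  /\
  (~~ odd r ->
   exists G : sgraph ((3 * r) %/ 2 + 1)%N,
     [/\ connected_graph G, cograph G
       & is_regularity (binomial_edge_ideal (K:=K) G) (Posz r)])
  /\
  (odd r ->
   exists G : sgraph ((3 * (r + 3)) %/ 2)%N,
     [/\ connected_graph G, cograph G
       & is_regularity (binomial_edge_ideal (K:=K) G) (Posz r)]).
Proof.
have even : ~~ odd r -> exists G : sgraph ((3 * r) %/ 2 + 1)%N,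
     [/\ connected_graph G, cograph G
       & is_regularity (binomial_edge_ideal (K:=K) G) (Posz r)].
  move=> re; apply: cone_graph_exists; first by case: r hr re => [|[]].
  (* Tight for [k = r - 1]: the last path vertex is immediately followed by the apex. *)
  by move=> k kr; rewrite /path_start; lia.
have oddr : odd r -> exists G : sgraph ((3 * (r + 3)) %/ 2)%N,
     [/\ connected_graph G, cograph G
       & is_regularity (binomial_edge_ideal (K:=K) G) (Posz r)].
  move=> ro; have [r1|r1] := leqP r 1.
    have -> : r = 1%N by lia.
    exact: complete_graph_regularity.
  by apply: cone_graph_exists => // k kr; rewrite /path_start; lia.
split=> //; case: (boolP (odd r)) => [/oddr|/even] [G hG]; by exists _, G.
Qed.
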